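(* Let $R$ be a field, $m,n\ge1$, and $Q=(q_1,\dots,q_m)\in R^m$ separated. Let $\boldsymbol\lambda=(\lambda^1;\dots;\lambda^m)$ be an $m$-multipartition of $n$. Then the Schur element of the degenerate cyclotomic Hecke algebra $\mathcal H_{m,n}(Q)$ associated to $\boldsymbol\lambda$ is $$s_{\boldsymbol\lambda}(Q)=\prod_{1\le s\le m}\prod_{(i,j)\in[\lambda^s]}\prod_{1\le t\le m}(h^{\lambda^s, \lambda^t}_{i,j}+q_s-q_t)=\prod_{1\le s\le m}\prod_{(i,j)\in[\lambda^s]}\biggl(h^{\lambda^s}_{i,j}\prod_{1\le t\le m,\ t\neq s}(h^{\lambda^s, \lambda^t}_{i,j}+q_s-q_t)\biggr).$$
   Context: For partitions $\lambda,\mu$ and $(i,j)\in[\lambda]=\{(i,j):1\le j\le\lambda_i\}$, $h^{\lambda,\mu}_{i,j}=\lambda_i-i+\bar\mu_j-j+1$ where $\bar\mu_j$ is the number of $i$ with $\mu_i\ge j$; $h^\lambda_{i,j}=h^{\lambda,\lambda}_{i,j}$ is the usual hook length. For a commutative ring $R$ and $Q=(q_1,\dots,q_m)\in R^m$, $\mathcal H_{m,n}(Q)$ is the unital $R$-algebra generated by $s_0,\dots,s_{n-1}$ subject to: $(s_0-q_1)\cdots(s_0-q_m)=0$; $s_0(s_1s_0s_1+s_1)=(s_1s_0s_1+s_1)s_0$; $s_i^2=1$ ($1\le i<n$); $s_is_{i+1}s_i=s_{i+1}s_is_{i+1}$; $s_is_j=s_js_i$ for $|i-j|>1$. Jucys–Murphy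 elements: $x_1=s_0$, $x_{i+1}=s_ix_is_i+s_i$. It is $R$-free with basis $\{x_1^{i_1}\cdots x_n^{i_n}w: 0\le i_k<m,\ w\in\langle s_1,\dots,s_{n-1}\rangle\cong S_n\}$, and $\tau(x_1^{i_1}\cdots x_n^{i_n}w)=1$ if all $i_k=m-1$ and $w=1$, else $0$, defines a non-degenerate trace form. $Q$ is separated if $n!\prod_{i<j}\prod_{|d|<n}(d+q_i-q_j)$ is invertible. An $m$-multipartition of $n$ is $(\lambda^1;\dots;\lambda^m)$ with $\sum|\lambda^s|=n$. When $R$ is a field and $Q$ is separated, the algebra is split semisimple with simple modules $S^{\boldsymbol\lambda}$, where $S^{\boldsymbol\lambda}$ has a basis $\{v_{\mathfrak t}\}$ indexed by standard $\boldsymbol\lambda$-tableaux with $x_kv_{\mathfrak t}=(j-i+q_c)v_{\mathfrak t}$ when $\mathfrak t$ places $k$ at node $(i,j,c)$ (row $i$, column $j$ of component $c$). With $\chi^{\boldsymbol\lambda}$ its character, the Schur elements are the $s_{\boldsymbol\lambda}(Q)\in R$ with $\tau=\sum_{\boldsymbol\lambda}\chi^{\boldsymbol\lambda}/s_{\boldsymbol\lambda}(Q)$. *)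

(* Defs.v *)
From HB Require Import structures.
From mathcomp Require Import all_boot all_order all_fingroup all_algebra all_field.
Set Implicit Arguments. Unset Strict Implicit. Unset Printing Implicit Defensive.
Import Order.TTheory GRing.Theory Num.Theory.
Local Open Scope ring_scope.

(* ---------- Combinatorics (all rows/columns/components 0-indexed) ---------- *)

(* An m-tuple of partitions with at most n rows, each row of length <= n,
   given by its row lengths lam c i (row i of component c).  Every partition of
   size <= n has this shape, so m-multipartitions of n are exactly the mpart ones. *)
Definition MP (m n : nat) := {ffun 'I_m -> {ffun 'I_n -> 'I_n.+1}}.

Definition mpart (m n : nat) (lam : MP m n) : bool :=
  [forall c, forall i : 'I_n, forall j : 'I_n,
     (i <= j)%N ==> (lam c j <= lam c i)%N]
  && ((\sum_(c < m) \sum_(i < n) (lam c i : nat))%N == n).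

Definition conjp (m n : nat) (lam : MP m n) (c : 'I_m) (j : nat) : nat :=
  #|[set r : 'I_n | (j < lam c r)%N]|.

(* generalized hook h^{lam^s, lam^t}_{i+1, j+1} with 0-indexed i, j:
   lam^s_{i+1} - (i+1) + conj(lam^t)_{j+1} - (j+1) + 1 *)
Definition ghook (m n : nat) (lam : MP m n) (s t : 'I_m) (i j : 'I_n) : int :=
  (lam s i : nat)%:Z - (i.+1)%:Z + (conjp lam t j)%:Z - (j.+1)%:Z + 1.

Definition schur1 (R : comRingType) (m n : nat) (q : 'I_m -> R) (lam : MP m n) : R :=
  \prod_(s < m) \prod_(i < n) \prod_(j < n | (j < lam s i)%N)
     \prod_(t < m) ((ghook lam s t i j)%:~R + q s - q t).

Definition schur2 (R : comRingType) (m n : nat) (q : 'I_m -> R) (lam : MP m n) : R :=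
  \prod_(s < m) \prod_(i < n) \prod_(j < n | (j < lam s i)%N)
     ((ghook lam s s i j)%:~R *
        \prod_(t < m | t != s) ((ghook lam s t i j)%:~R + q s - q t)).

(* A tableau: T k = ((i, j), c) is the node (row i, column j, component c)
   containing the entry k+1. *)
Definition tableau (m n : nat) := {ffun 'I_n -> 'I_n * 'I_n * 'I_m}.

Definition is_node (m n : nat) (lam : MP m n) (x : 'I_n * 'I_n * 'I_m) : bool :=
  (x.1.2 < lam x.2 x.1.1)%N.

Definition standard (m n : nat) (lam : MP m n) (T : tableau m n) : bool :=
  [&& injectiveb T,
      [forall k, is_node lam (T k)],
      [forall x, is_node lam x ==> (x \in codom T)],
      [forall k, forall k',
         [&& (T k).2 == (T k').2, (T k).1.1 == (T k').1.1
           & ((T k).1.2 < (T k').1.2)%N] ==> (k < k')%N] &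
      [forall k, forall k',
         [&& (T k).2 == (T k').2, (T k).1.2 == (T k').1.2
           & ((T k).1.1 < (T k').1.1)%N] ==> (k < k')%N]].

Definition stdT (m n : nat) (lam : MP m n) : {set tableau m n} :=
  [set T | standard lam T].

(* eigenvalue of x_{k+1} on v_T : (j - i) + q_c for node (i,j,c) (1-indexed
   difference = 0-indexed difference) *)
Definition content (R : ringType) (m n : nat) (q : 'I_m -> R) (T : tableau m n)
    (k : 'I_n) : R :=
  ((T k).1.2)%:R - ((T k).1.1)%:R + q (T k).2.

(* Q separated: n! * prod_{i<j} prod_{|d|<n} (d + q_i - q_j) invertible *)
Definition separated (R : fieldType) (m n : nat) (q : 'I_m -> R) : Prop :=
  (n`!)%:R * \prod_(i < m) \prod_(j < m | (i < j)%N)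
     \prod_(d < (n + n).-1) (((d : nat)%:Z - (n.-1)%:Z)%:~R + q i - q j) != 0.

Definition hecke_rel (R : fieldType) (A : falgType R) (m n : nat)
    (q : 'I_m -> R) (s : nat -> A) : Prop :=
  [/\ \prod_(c < m) (s 0%N - (q c)%:A) = 0,
      (1 < n)%N -> s 0%N * (s 1%N * s 0%N * s 1%N + s 1%N)
                  = (s 1%N * s 0%N * s 1%N + s 1%N) * s 0%N,
      (forall i, (0 < i < n)%N -> s i * s i = 1),
      (forall i, (0 < i)%N -> (i.+1 < n)%N -> s i * s i.+1 * s i = s i.+1 * s i * s i.+1)
    & (forall i j, (i < n)%N -> (j < n)%N -> (i.+1 < j)%N || (j.+1 < i)%N ->
         s i * s j = s j * s i)].

(* Jucys--Murphy elements: jm s k = x_{k+1};  x_1 = s_0, x_{k+2} = s_{k+1} x_{k+1} s_{k+1} + s_{k+1} *)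
Fixpoint jm (R : ringType) (A : lalgType R) (s : nat -> A) (k : nat) : A :=
  match k with
  | 0 => s 0%N
  | k'.+1 => s k * jm s k' * s k + s k
  end.

(* index set of the standard basis: exponents (i_1,...,i_n) in [0,m) and w in S_n *)
Definition HIdx (m n : nat) := ({ffun 'I_n -> 'I_m} * {perm 'I_n})%type.

(* basis element x_1^{i_1} ... x_n^{i_n} w, with g : S_n -> A the embedding *)
Definition mono (R : ringType) (A : lalgType R) (m n : nat) (s : nat -> A)
    (g : {perm 'I_n} -> A) (p : HIdx m n) : A :=
  (\prod_(k < n) jm s k ^+ (p.1 k)) * g p.2.

Definition topidx (m n : nat) (p : HIdx m n) : bool :=
  [forall k, (p.1 k : nat) == m.-1] && (p.2 == 1%g).

(* trace form tau, applied to the element with coordinates c in the basis mono *)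
Definition tauc (R : ringType) (m n : nat) (c : HIdx m n -> R) : R :=
  \sum_(p | topidx p) c p.

(* Main.v *)
Require Import Defs.
From HB Require Import structures.
From mathcomp Require Import all_boot all_order all_fingroup all_algebra all_field.
From mathcomp Require Import zify ring.
Import Order.TTheory GRing.Theory Num.Theory.
Local Open Scope ring_scope.

(** A standard tableau is read as a lattice word, recording the row in which each
    entry is placed. By induction on r, the character of the subalgebra generated by
    s_0, ..., s_(r-1) on any module whose weights are the contents of the standard
    tableaux of a shape depends only on the shape: a permutation moving the last letter
    is u s_r v with u and v fixing it, and the block of s_r preserving the position of
    the last node is diagonal with entries 1 / (c_(r+1) - c_r). The same reduction
    evaluates the sum of the characters weighted by inverse hook products on the
    monomials: removing the last node turns it into
      sum_p c_p^a W_p   or   sum_p c_p^a W_p / (c_p - c_B)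
    over the addable nodes p of a shape, where B is removable and
      W_p = prod_(B' removable) (c_p - c_B') / prod_(p' <> p addable) (c_p - c_p')
    is the ratio of two consecutive hook products. As there are m more addable than
    removable nodes, Lagrange interpolation gives [a = m - 1], respectively 0, for
    a < m. Uniqueness holds since polynomials in the Jucys--Murphy elements separate
    the weights. *)

Set Implicit Arguments. Unset Strict Implicit. Unset Printing Implicit Defensive.

(** * Lattice words *)

(** The matrices of s_1, ..., s_(n-1) on S^lambda are not given, and no seminormal form is
    constructed; only the weights of the x_k are known. These weights force the block structure: an
    element of the r-th subalgebra commutes with x_(r+1), ..., x_n, so it preserves the positions of
    the later entries, and s_i x_(i+1) = x_i s_i + 1 determines the diagonal entries of s_i. The
    factor 1 / (c_(r+1) - c_r) depends on two entries of the tableau. With the last node fixed it is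
    a function of c_r alone, and interpolating this function by a polynomial in x_r turns the
    weighted trace back into a combination of characters of the smaller subalgebra. As characters
    depend only on the shape mu, the blocks mu of S^(mu + p) for the various addable p may all be
    replaced by one of them, and the sum over p then acts on scalars only. The formula for W_p comes
    from an identity along the boundary of the shape. It is proved for polynomials, because at the
    content c_p itself both sides vanish and a common factor has to be cancelled first. *)

Section Words.
Variables (m n : nat).
Local Notation row := ('I_m * 'I_n)%type.
Local Notation shp := {ffun row -> nat}.

Definition wshape (Y : seq row) : shp := [ffun p => count_mem p Y].

(** All earlier rows of the component are compared, not only the preceding one. For partitions this
    is the same, and row 0 is addable to every shape. *)
Definition addable (la : shp) (p : row) : bool :=
  [forall j : 'I_n, (j < p.2)%N ==> (la p < la (p.1, j))%N].

Definition add_row (la : shp) (p : row) : shp := [ffun r => (la r + (r == p))%N].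
Definition sub_row (la : shp) (p : row) : shp := [ffun r => (la r - (r == p))%N].
(* Weaker than removability: [sub_row la p] need not be a partition. *)
Definition strippable (la : shp) (p : row) : bool :=
  (0 < la p)%N && addable (sub_row la p) p.

Definition partp (la : shp) : Prop :=
  forall (c : 'I_m) (i j : 'I_n), (i <= j)%N -> (la (c, j) <= la (c, i))%N.

Definition shsize (la : shp) : nat := (\sum_p la p)%N.

(* Words are read from right to left: the head is the row of the last node. *)
Fixpoint lword (Y : seq row) : bool :=
  if Y is p :: Y' then addable (wshape Y') p && lword Y' else true.

Fixpoint lwords (r : nat) : seq (seq row) :=
  if r is r'.+1 then
    [seq p :: Y | Y <- lwords r', p <- [seq p <- enum {: row} | addable (wshape Y) p]]
  else [:: [::]].

Lemma addableP (la : shp) (p : row) :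
  reflect (forall j : 'I_n, (j < p.2)%N -> (la p < la (p.1, j))%N) (addable la p).
Proof. by apply: (iffP forallP) => h j; [move: (h j) => /implyP | apply/implyP; apply: h]. Qed.

Lemma shape_cons p Y : wshape (p :: Y) = add_row (wshape Y) p.
Proof. by apply/ffunP => r; rewrite !ffunE /= addnC eq_sym. Qed.

Lemma add_rowK p : cancel (add_row^~ p) (sub_row^~ p).
Proof. by move=> la; apply/ffunP => r; rewrite !ffunE addnK. Qed.

Lemma sub_rowK (la : shp) p : (0 < la p)%N -> add_row (sub_row la p) p = la.
Proof. by move=> h; apply/ffunP => r; rewrite !ffunE; case: eqP => [->|_] /=; lia. Qed.

Lemma add_row_eq (la mu : shp) p :
  addable mu p && (add_row mu p == la) = strippable la p && (mu == sub_row la p).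
Proof.
apply/andP/andP => [[ha /eqP <-]|[/andP[hp ha] /eqP ->]].
  by rewrite /strippable add_rowK eqxx ha !ffunE eqxx addn1.
by rewrite sub_rowK.
Qed.

Lemma shsize_add la p : shsize (add_row la p) = (shsize la).+1.
Proof.
rewrite /shsize; under eq_bigr do rewrite ffunE.
by rewrite big_split /= -big_mkcond /= big_pred1_eq addn1.
Qed.

Lemma shsize_shape Y : shsize (wshape Y) = size Y.
Proof.
elim: Y => [|p Y IH]; last by rewrite shape_cons shsize_add IH.
by rewrite /shsize big1 // => p _; rewrite ffunE.
Qed.

Lemma partp_add la p : partp la -> addable la p -> partp (add_row la p).
Proof.
move=> hla /addableP hp c i j ij; rewrite !ffunE.
have h := hla c i j ij; case: eqP => [E|_] /=; last by rewrite addn0 (leq_trans h) ?leq_addr.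
case: eqP => [_|] /=; first by lia.
move=> ne; suff: (la (c, j) < la (c, i))%N by lia.
have {1}-> : (c, j) = p by [].
have -> : c = p.1 by rewrite -E.
apply: hp; rewrite -E /= ltn_neqAle ij andbT.
by apply: contraPneq E => e; have -> : j = i by apply: val_inj.
Qed.

Lemma partp_shape Y : lword Y -> partp (wshape Y).
Proof.
elim: Y => [|p Y IH] /=; first by move=> _ c i j _; rewrite !ffunE.
by case/andP=> ha /IH h; rewrite shape_cons; apply: partp_add.
Qed.

Lemma mem_lwords r Y : (Y \in lwords r) = (size Y == r) && lword Y.
Proof.
elim: r Y => [|r IH] [|p Y] //=.
  by apply/negbTE/allpairsPdep => -[? [? []]].
rewrite eqSS; apply/allpairsPdep/idP => [[Z [t [hZ]]]|].
  by rewrite mem_filter => /andP[ha _] [-> ->]; rewrite ha -IH.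
move=> /and3P[hs ha hY]; exists Y, p; split=> //; first by rewrite IH hs.
by rewrite mem_filter ha mem_enum.
Qed.

Lemma lwords_uniq r : uniq (lwords r).
Proof.
elim: r => //= r IH; apply: allpairs_uniq_dep => //.
  by move=> Y _; rewrite filter_uniq // enum_uniq.
by move=> [Y p] [Z t] _ _ /= [-> ->].
Qed.

Lemma big_lwords (S : Type) (idx : S) (op : Monoid.com_law idx) r P (F : seq row -> S) :
  \big[op/idx]_(Y <- lwords r.+1 | P Y) F Y
  = \big[op/idx]_(Y <- lwords r)
      \big[op/idx]_(p | addable (wshape Y) p && P (p :: Y)) F (p :: Y).
Proof.
rewrite big_mkcond big_allpairs_dep; apply: eq_bigr => Y _.
by rewrite big_filter big_enum_cond /= big_mkcondr.
Qed.

Lemma big_lwords_shape (S : Type) (idx : S) (op : Monoid.com_law idx) r (la : shp)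
    (F : seq row -> S) :
  \big[op/idx]_(Y <- lwords r.+1 | wshape Y == la) F Y
  = \big[op/idx]_(p | strippable la p)
      \big[op/idx]_(Y <- lwords r | wshape Y == sub_row la p) F (p :: Y).
Proof.
rewrite big_lwords; under eq_bigr do rewrite big_mkcond /=.
rewrite exchange_big /= [RHS]big_mkcond /=; apply: eq_bigr => p _.
rewrite -big_mkcond /=; under eq_bigl do rewrite shape_cons add_row_eq.
by case: (strippable la p) => //=; rewrite big_pred0_eq.
Qed.

Lemma eq_sum_by_shape (V : nmodType) r (F G : seq row -> V) :
  (forall la, \sum_(Y <- lwords r | wshape Y == la) F Y
              = \sum_(Y <- lwords r | wshape Y == la) G Y) ->
  \sum_(Y <- lwords r) F Y = \sum_(Y <- lwords r) G Y.
Proof.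
(* Shapes take values in [nat] and do not form a finite type, so the outer sum runs over the list of
   shapes that occur. *)
move=> h; set L := undup (map wshape (lwords r)).
have part H : \sum_(Y <- lwords r) H Y
    = \sum_(la <- L) \sum_(Y <- lwords r | wshape Y == la) H Y :> V.
  under [RHS]eq_bigr do rewrite big_mkcond.
  rewrite exchange_big /= big_seq_cond [RHS]big_seq_cond.
  apply: eq_bigr => Y; rewrite andbT => hY.
  rewrite (bigD1_seq (wshape Y)) ?undup_uniq ?mem_undup ?map_f //= eqxx.
  by rewrite big1 ?addr0 // => la; rewrite eq_sym => /negbTE ->.
by rewrite !part; apply: eq_bigr.
Qed.

Lemma lwords_shape_exists r la :
  partp la -> shsize la = r -> exists2 Y, Y \in lwords r & wshape Y = la.
Proof.
elim: r la => [|r IH] la hla hs.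
  exists [::] => //; apply/ffunP => p; rewrite !ffunE /=; symmetry.
  by have := leqnn (shsize la); rewrite {2}hs leqn0 sum_nat_eq0 => /forallP /(_ p) /eqP.
have [p hp] : exists p, (0 < la p)%N.
  apply/existsP; apply: contra_eqT hs => /existsPn h.
  by rewrite /shsize big1 // => p _; have := h p; rewrite -eqn0Ngt => /eqP.
(* The last node of the lowest nonempty row of a component can be removed. *)
pose c : 'I_m := p.1; pose i : 'I_n := [arg max_(i > p.2 | 0 < la (c, i)) (i : nat)]%N.
have [hi imax] : (0 < la (c, i))%N /\ (forall j, (0 < la (c, j))%N -> (j <= i)%N).
  by rewrite /i; case: arg_maxnP => [|j ? ?]; [rewrite /c -surjective_pairing|].
have E := sub_rowK hi.
have ha : addable (sub_row la (c, i)) (c, i).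
  apply/addableP => j /= ji; rewrite !ffunE /= eqxx.
  have := hla c j i (ltnW ji); case: eqP => [[e]|_] /=; last by lia.
  by rewrite e ltnn in ji.
have hm : partp (sub_row la (c, i)).
  move=> d j k jk; rewrite !ffunE; have := hla d j k jk.
  case: eqP => [[ed ek]|] /=; first by lia.
  case: eqP => [[ed ej]|] /=; last by lia.
  move=> ne; suff -> : la (d, k) = 0%N by lia.
  apply/eqP; rewrite eqn0Ngt; apply/negP; rewrite ed => /imax ki.
  by apply: ne; rewrite ed; congr pair; apply: val_inj; rewrite /= ej in jk *; lia.
have [|Y hY hsY] := IH _ hm.
  by have := shsize_add (sub_row la (c, i)) (c, i); rewrite E hs => -[].
exists ((c, i) :: Y); last by rewrite shape_cons hsY.
by rewrite mem_lwords /= eqSS hsY ha -mem_lwords.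
Qed.

End Words.

(** * Contents and hooks *)

Section Contents.
Variables (R : fieldType) (m n : nat) (q : 'I_m -> R).
Hypothesis hsep : separated n q.
Local Notation row := ('I_m * 'I_n)%type.
Local Notation shp := {ffun row -> nat}.

Lemma sep_natr k : (0 < k <= n)%N -> k%:R != 0 :> R.
Proof.
move=> hk; have := hsep; rewrite /separated mulf_eq0 negb_or => /andP[h _].
by have /dvdnP[d E] := dvdn_fact hk; move: h; rewrite E natrM mulf_eq0 negb_or => /andP[].
Qed.

Lemma sep_cross (s t : 'I_m) a b : s != t -> (a < b + n)%N -> (b < a + n)%N ->
  a%:R - b%:R + q s - q t != 0.
Proof.
have main (u v : 'I_m) c d : (u < v)%N -> (c < d + n)%N -> (d < c + n)%N ->
    c%:R - d%:R + q u - q v != 0.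
  move=> uv h1 h2; have := hsep; rewrite /separated mulf_eq0 negb_or => /andP[_].
  move=> /prodf_neq0 /(_ u isT) /prodf_neq0 /(_ v uv) /prodf_neq0 h.
  (* [separated] encodes the integers from 1 - n to n - 1 as an index minus n - 1, whence this index
     for c - d. *)
  have hi : (c + n.-1 - d < (n + n).-1)%N by lia.
  move: (h (Ordinal hi) isT) => /=; rewrite -subzn; last by lia.
  rewrite PoszD !rmorphB rmorphD /= -!pmulrn; apply: contra_neq => E0.
  by rewrite -[RHS]E0; ring.
move=> st h1 h2; case: (ltngtP s t) => [/main|/main|e]; first exact.
  move=> /(_ b a h2 h1); apply: contra_neq => E.
  by rewrite -[RHS]oppr0 -[in RHS]E; ring.
by case/negP: st; apply/eqP/val_inj.
Qed.

(** Content of the first free node of row [p]; the last node of the row has this content minus 1. *)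
Definition rowend (la : shp) (p : row) : R := (la p)%:R - (p.2 : nat)%:R + q p.1.

Definition conjc (la : shp) (t : 'I_m) (j : nat) : nat :=
  (\sum_(i < n) (j < la (t, i)))%N.

Lemma sum_row_delta (t : 'I_m) (P : 'I_n -> nat) :
  (\sum_(r : row) (r.1 == t) * P r.2 = \sum_i P i)%N.
Proof.
rewrite -(pair_bigA _ (fun a b => (a == t) * P b)%N) /= (bigD1 t) //=.
rewrite [X in (_ + X)%N]big1 ?addn0; first by apply: eq_bigr => i _; rewrite eqxx mul1n.
by move=> a /negbTE ->; rewrite big1.
Qed.

Lemma sum_delta (la : shp) (p : row) : (\sum_r (r == p) * la r = la p)%N.
Proof.
rewrite (bigD1 p) //= eqxx mul1n big1 ?addn0 // => r /negbTE ->.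
by rewrite mul0n.
Qed.

Lemma sum_ltn k : (k <= n)%N -> (\sum_(i < n) (i < k) = k)%N.
Proof.
move=> kn; rewrite -{2}[k]card_ord -sum1_card (big_ord_widen n (fun=> 1%N) kn).
by rewrite [RHS]big_mkcond; apply: eq_bigr => i _; case: (_ < _)%N.
Qed.

(** Rows [p] and [p'] are disjoint, and each row above [p'] contributes its first node. Only one
    node of row [p] can be counted twice, and only when [p] lies in the component of [p']. *)
Lemma rows_bound (la : shp) (p p' : row) : p != p' ->
  (forall j : 'I_n, (j < p'.2)%N -> (0 < la (p'.1, j))%N) ->
  (la p + la p' + p'.2 <= shsize la + (p.1 == p'.1))%N.
Proof.
move=> ne h; rewrite -(sum_delta la p) -(sum_delta la p').
rewrite -(sum_ltn (ltnW (ltn_ord p'.2))) -(sum_row_delta p'.1).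
have -> : ((p.1 == p'.1) = \sum_(r : row) (r == p) * (p.1 == p'.1) :> nat)%N.
  by rewrite (bigD1 p) //= eqxx mul1n big1 ?addn0 // => r /negbTE ->.
rewrite /shsize -!big_split /=; apply: leq_sum => r _.
case: (r =P p) => [->|/eqP hrp] /=.
  rewrite (negbTE ne) /=; case: (p.1 == p'.1) => /=; case: (_ < _)%N; lia.
case: (r =P p') => [->|hr] /=; first by rewrite ltnn muln0; lia.
case: (r.1 =P p'.1) => [E|_] /=; last by lia.
by case: ltnP => hr2; rewrite ?mul1n ?muln0 // !add0n addn0 [r]surjective_pairing E h.
Qed.

(** A row and a column share at most one node, and none across components. *)
Lemma conjc_bound (la : shp) (p : row) (t : 'I_m) j :
  (la p + conjc la t j <= shsize la + (p.1 == t))%N.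
Proof.
rewrite -(sum_delta la p) /conjc -(sum_row_delta t).
have -> : ((p.1 == t) = \sum_(r : row) (r == p) * (p.1 == t) :> nat)%N.
  by rewrite (bigD1 p) //= eqxx mul1n big1 ?addn0 // => r /negbTE ->.
rewrite /shsize -!big_split /=; apply: leq_sum => r _.
case: (r =P p) => [->|/eqP hrp] /=.
  by case: (p.1 =P t) => [<-|] /=; rewrite -?surjective_pairing; case: (j < _)%N; lia.
case: (r.1 =P t) => [<-|] /=; last by lia.
by rewrite -surjective_pairing; lia.
Qed.

(** In one component the difference is, up to sign, an integer between 1 and n; across components
    [sep_cross] applies. The size bounds serve two cases: addable rows of shapes with fewer than n
    nodes, and nonempty rows of shapes with at most n nodes. *)
Lemma rowend_inj (la : shp) (p p' : row) : partp la -> p != p' ->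
  (forall j : 'I_n, (j < p.2)%N -> (0 < la (p.1, j))%N) ->
  (forall j : 'I_n, (j < p'.2)%N -> (0 < la (p'.1, j))%N) ->
  (shsize la < n + la p)%N -> (shsize la < n + la p')%N ->
  rowend la p != rowend la p'.
Proof.
move=> hla; wlog le : p p' / (p.2 <= p'.2)%N.
  move=> IH ne h h' b b'; case: (leqP p.2 p'.2) => [|/ltnW] le; first exact: IH.
  by rewrite eq_sym; apply: IH => //; rewrite eq_sym.
move=> ne h h' b b'; have B := rows_bound ne h'.
have B' := rows_bound (_ : p' != p) h; rewrite eq_sym ne in B'; have {}B' := B' isT.
rewrite -subr_eq0 /rowend; case: (p.1 =P p'.1) => [E|/eqP ne1].
  move: B; rewrite E eqxx => B.
  have lt : (p.2 < p'.2)%N.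
    rewrite ltn_neqAle le andbT; apply: contra ne => /eqP e2; apply/eqP.
    by rewrite [p]surjective_pairing [p']surjective_pairing E; congr pair; apply: val_inj.
  have := hla p'.1 _ _ le; rewrite -{2}E -!surjective_pairing => hle.
  have hk : (0 < la p + p'.2 - (la p' + p.2) <= n)%N by lia.
  have := sep_natr hk; rewrite natrB ?natrD; last by lia.
  by apply: contra_neq => E0; rewrite -[RHS]E0; ring.
move: B B'; rewrite [p'.1 == _]eq_sym (negbTE ne1) /= => B B'.
have := @sep_cross p.1 p'.1 (la p + p'.2) (la p' + p.2) ne1.
rewrite !natrD => H; apply: contra_neq (H _ _) => [E0||]; [|lia|lia].
by rewrite -[RHS]E0; ring.
Qed.

Lemma addable_pos (la : shp) p : addable la p ->
  forall j : 'I_n, (j < p.2)%N -> (0 < la (p.1, j))%N.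
Proof. by move=> /addableP h j /h; lia. Qed.

Lemma rowend_addable_inj (la : shp) p p' : partp la -> (shsize la < n)%N ->
  addable la p -> addable la p' -> p != p' -> rowend la p != rowend la p'.
Proof.
by move=> hla hs hp hp' ne; apply: rowend_inj => //; try exact: addable_pos; lia.
Qed.

Lemma rowend_sub (la : shp) p : (0 < la p)%N -> rowend (sub_row la p) p = rowend la p - 1.
Proof. by move=> h; rewrite /rowend ffunE eqxx natrB //=; ring. Qed.

Lemma strippable_pos (la : shp) p : strippable la p ->
  forall j : 'I_n, (j < p.2)%N -> (0 < la (p.1, j))%N.
Proof. by move=> /andP[_ /addableP h] j /h; rewrite !ffunE /=; lia. Qed.

Lemma rowend_strippable_inj (la : shp) p p' : partp la -> (shsize la <= n)%N ->
  strippable la p -> strippable la p' -> p != p' ->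
  rowend (sub_row la p) p != rowend (sub_row la p') p'.
Proof.
move=> hla hs hp hp' ne; have [h _] := andP hp; have [h' _] := andP hp'.
rewrite !rowend_sub // (inj_eq (addIr _)).
by apply: rowend_inj => //; try exact: strippable_pos; lia.
Qed.

(** [a] stands for the length of row [i] of component [s]; the constant -1 comes from counting rows
    and columns from 0. *)
Definition hook (la : shp) (s t : 'I_m) (i j : nat) (a : nat) : R :=
  a%:R - i%:R + (conjc la t j)%:R - j%:R - 1 + q s - q t.

Definition hookprod (la : shp) : R :=
  \prod_(p : row) \prod_(0 <= j < la p) \prod_t hook la p.1 t p.2 j (la p).

Lemma ltn_conjc (la : shp) t j (i : 'I_n) : partp la ->
  (i < conjc la t j)%N = (j < la (t, i))%N.
Proof.
move=> hla; apply/idP/idP => [|h].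
  apply: contraTT; rewrite -!leqNgt => h.
  rewrite -(sum_ltn (ltnW (ltn_ord i))) /conjc; apply: leq_sum => k _.
  case: (ltnP k i) => [_|ik]; first by rewrite leq_b1.
  by rewrite ltnNge (leq_trans _ h) ?hla.
rewrite -(sum_ltn (ltn_ord i)) /conjc; apply: leq_sum => k _; rewrite ltnS.
by case: (leqP k i) => // ki; rewrite (leq_trans h) ?hla.
Qed.

(** Within a component this is a usual hook length, between 1 and the number of nodes; across
    components [conjc_bound] keeps the integer part in the range of separation. *)
Lemma hook_neq0 (la : shp) (p : row) (t : 'I_m) j : partp la -> (shsize la <= n)%N ->
  (j < la p)%N -> hook la p.1 t p.2 j (la p) != 0.
Proof.
move=> hla hs hj; have B := conjc_bound la p t j; rewrite /hook.
case: (p.1 =P t) B => [<-|/eqP ne] /= B.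
  have hc : (p.2 < conjc la p.1 j)%N by rewrite ltn_conjc // -surjective_pairing.
  have hk : (0 < la p + conjc la p.1 j - (p.2 + j + 1) <= n)%N by lia.
  have := sep_natr hk; rewrite natrB ?natrD; last by lia.
  by apply: contra_neq => E0; rewrite -[RHS]E0; ring.
have hp := ltn_ord p.2.
have := @sep_cross p.1 t (la p + conjc la t j) (p.2 + j + 1) ne.
rewrite !natrD => H; apply: contra_neq (H _ _) => [E0||]; [|lia|lia].
by rewrite -[RHS]E0; ring.
Qed.

Lemma hookprod_neq0 (la : shp) : partp la -> (shsize la <= n)%N -> hookprod la != 0.
Proof.
move=> hla hs; apply/prodf_neq0 => p _; rewrite prodf_seq_neq0; apply/allP.
move=> j; rewrite mem_index_iota => /andP[_ hj]; apply/prodf_neq0 => t _.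
by apply: hook_neq0.
Qed.

End Contents.

(** * The rim of a partition *)

Section Rim.
Variables (S : idomainType) (x : S) (l cj : nat -> nat) (n : nat).
Hypothesis ltn_cj : forall i j, (i < cj j)%N = (j < l i)%N.
Hypothesis cj0_lt : (cj 0 < n)%N.
Hypothesis x_nat : forall a b : nat, x - a%:R + b%:R != 0.

Let add i := (i == 0%N) || (l i < l i.-1)%N.
Let rem i := (l i.+1 < l i)%N.

(** Telescoping: y + i + 1 is the unshifted factor of the next index. *)
Lemma prod_shift (y : S) k h : (k <= h)%N ->
  (y + k%:R) * \prod_(k <= i < h) (y + i%:R + 1) = (y + h%:R) * \prod_(k <= i < h) (y + i%:R).
Proof.
elim: h => [|h IH]; first by rewrite leqn0 => /eqP ->; rewrite !big_geq.
rewrite leq_eqVlt => /orP[/eqP ->|]; first by rewrite !big_geq.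
rewrite ltnS => kh; rewrite !big_nat_recr //= mulrA IH // -natr1; ring.
Qed.

Lemma cj_decr b : (cj b.+1 <= cj b)%N.
Proof. by rewrite leqNgt ltn_cj; apply/negP => h; have := ltnn (cj b); rewrite ltn_cj ltnW. Qed.

Lemma cj_le0 b : (cj b <= cj 0)%N.
Proof. by elim: b => // b; apply: leq_trans; apply: cj_decr. Qed.

(** Induction on the columns: the rows i with [cj b.+1 <= i < cj b] all have length b + 1, so their
    factors form a run that [prod_shift] collapses to its ends. *)
Lemma rim_columns b :
  \prod_(0 <= j < b.+1) (x - j%:R + (cj j)%:R)
    * \prod_(cj b <= i < cj 0) (x - (l i)%:R + i%:R + 1)
  = (x + (cj 0)%:R) * \prod_(cj b <= i < cj 0) (x - (l i)%:R + i%:R)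
    * \prod_(0 <= j < b) (x - j%:R + (cj j)%:R - 1).
Proof.
elim: b => [|b IH]; first by rewrite big_nat1 !big_geq // subr0 !mulr1.
rewrite big_nat_recr //= [in RHS]big_nat_recr //=.
rewrite !(big_cat_nat (cj_decr b) (cj_le0 b)) /=.
have E i : (cj b.+1 <= i < cj b)%N -> l i = b.+1.
  by rewrite leqNgt !ltn_cj -leqNgt => /andP[h1 h2]; apply/eqP; rewrite eqn_leq h1.
have E1 : \prod_(cj b.+1 <= i < cj b) (x - (l i)%:R + i%:R + 1)
    = \prod_(cj b.+1 <= i < cj b) (x - b.+1%:R + i%:R + 1) by apply: eq_big_nat => i /E ->.
have E2 : \prod_(cj b.+1 <= i < cj b) (x - (l i)%:R + i%:R)
    = \prod_(cj b.+1 <= i < cj b) (x - b.+1%:R + i%:R) by apply: eq_big_nat => i /E ->.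
rewrite E1 E2.
have T := prod_shift (x - b.+1%:R) (cj_decr b).
set P1 := \prod_(_ <= _ < _) (_ + _ + 1) in T *.
set P2 := \prod_(_ <= _ < _) (_ + _) in T *.
transitivity ((\prod_(0 <= j < b.+1) (x - j%:R + (cj j)%:R)
    * \prod_(cj b <= i < cj 0) (x - (l i)%:R + i%:R + 1))
    * ((x - b.+1%:R + (cj b.+1)%:R) * P1)); first by ring.
rewrite IH T -natr1; ring.
Qed.

Lemma l_cj0 i : (cj 0 <= i)%N -> l i = 0%N.
Proof. by rewrite leqNgt ltn_cj -leqNgt leqn0 => /eqP. Qed.

(** When rows i and i + 1 have equal length, the factor of row i + 1 is the shifted factor of row i.
    Where the length drops, row i is removable and row i + 1 addable, which supplies the missing
    factors. *)
Lemma rim_rows :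
  \prod_(0 <= i < cj 0) (x - (l i)%:R + i%:R) * (x + (cj 0)%:R)
    * \prod_(0 <= i < n | rem i) (x - (l i)%:R + i%:R + 1)
  = \prod_(0 <= i < n | add i) (x - (l i)%:R + i%:R)
    * \prod_(0 <= i < cj 0) (x - (l i)%:R + i%:R + 1).
Proof.
have -> : \prod_(0 <= i < cj 0) (x - (l i)%:R + i%:R) * (x + (cj 0)%:R)
    = \prod_(0 <= i < (cj 0).+1) (x - (l i)%:R + i%:R).
  by rewrite big_nat_recr //= l_cj0 // subr0.
have cut (F : nat -> S) k : (cj 0 <= k)%N ->
    \prod_(0 <= i < k | rem i) F i = \prod_(0 <= i < cj 0) (if rem i then F i else 1).
  move=> hk; rewrite (big_cat_nat (leq0n _) hk) /= [X in _ * X]big1_seq ?mulr1.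
    by rewrite big_mkcond.
  move=> i /andP[]; rewrite mem_index_iota /rem => h /andP[hi _]; move: h.
  by rewrite (l_cj0 hi) ltn0.
case: n cj0_lt => // k hk; rewrite cut; last by apply: ltnW.
rewrite !big_nat_recl //= [in RHS]big_mkcond big_nat_recl //=.
have -> : \prod_(0 <= i < k) (if add i.+1 then x - (l i.+1)%:R + i.+1%:R else 1)
    = \prod_(0 <= i < k | rem i) (x - (l i.+1)%:R + i.+1%:R) by rewrite [RHS]big_mkcond.
rewrite cut //.
rewrite -!mulrA -!big_split /=; congr (_ * _); apply: eq_bigr => i _.
rewrite /rem; case: ltnP => h; first by [].
suff -> : l i.+1 = l i by rewrite -natr1; ring.
apply/eqP; rewrite eqn_leq h andbT leqNgt -ltn_cj; apply/negP => hi.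
by have := ltnn (l i); rewrite -ltn_cj ltnW.
Qed.

(** Multiply [rim_columns] and [rim_rows] and cancel the rows i with [cj b <= i < cj 0]. The
    genericity of x, expressed by [x_nat], makes the cancelled product nonzero. *)
Lemma rim b :
  \prod_(0 <= j < b.+1) (x - j%:R + (cj j)%:R)
    * \prod_(0 <= i < cj b) (x - (l i)%:R + i%:R)
    * \prod_(0 <= i < n | rem i) (x - (l i)%:R + i%:R + 1)
  = \prod_(0 <= i < n | add i) (x - (l i)%:R + i%:R)
    * \prod_(0 <= j < b) (x - j%:R + (cj j)%:R - 1)
    * \prod_(0 <= i < cj b) (x - (l i)%:R + i%:R + 1).
Proof.
have Q0 : \prod_(cj b <= i < cj 0) (x - (l i)%:R + i%:R + 1) != 0.
  rewrite prodf_seq_neq0; apply/allP => i _; apply/implyP => _.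
  by have := x_nat (l i) i.+1; rewrite -natr1 addrA.
apply: (mulIf Q0); have := rim_rows; have := rim_columns b.
rewrite !(big_cat_nat (leq0n _) (cj_le0 b)) /= => E1 E2.
move: E1 E2.
set D := \prod_(0 <= j < b.+1) _; set Q2 := \prod_(cj b <= _ < _) _.
set P2 := \prod_(cj b <= _ < _) _; set E := \prod_(0 <= j < b) _.
set P := \prod_(0 <= i < cj b) _; set Q := \prod_(0 <= i < cj b) _.
set Rm := \prod_(0 <= i < n | rem i) _; set Ad := \prod_(0 <= i < n | add i) _.
move=> E1 E2; transitivity (D * Q2 * P * Rm); first by ring.
rewrite E1; transitivity (P * P2 * (x + (cj 0)%:R) * Rm * E); first by ring.
rewrite E2; ring.
Qed.

End Rim.

(** Compare top coefficients in Lagrange's formula: [F] equals its interpolant [G], and every [L i]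
    is monic of degree [#|D|.-1]. *)
Lemma sum_lagrange (R : fieldType) (I : finType) (D : pred I) (c : I -> R) (F : {poly R}) :
  {in D &, injective c} -> (size F <= #|D|)%N ->
  \sum_(i in D) F.[c i] / \prod_(j in D | j != i) (c i - c j) = F`_(#|D|.-1).
Proof.
move=> cinj hF.
have nz i : i \in D -> \prod_(j in D | j != i) (c i - c j) != 0.
  move=> hi; apply/prodf_neq0 => j /andP[hj ne]; rewrite subr_eq0.
  by apply: contra ne => /eqP e; apply/eqP; apply: cinj.
pose L i := \prod_(j in D | j != i) ('X - (c j)%:P).
pose G := \sum_(i in D) (F.[c i] / \prod_(j in D | j != i) (c i - c j)) *: L i.
have sL i : i \in D -> size (L i) = #|D|.
  move=> hi; rewrite /L -big_filter size_prod_XsubC size_filter.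
  rewrite (cardD1 i) hi add1n -sum1_card -sum1_count; congr _.+1.
  by apply: eq_bigl => j; rewrite !inE andbC.
have sG : (size G <= #|D|)%N.
  apply: (leq_trans (size_sum _ _ _)); apply/bigmax_leqP => i hi.
  by rewrite (leq_trans (size_scale_leq _ _)) ?sL.
have eG i : i \in D -> G.[c i] = F.[c i].
  move=> hi; rewrite /G horner_sum (bigD1 i) //= [X in _ + X]big1 => [|k /andP[hk ki]].
    rewrite addr0 hornerZ horner_prod.
    rewrite [X in _ * X](eq_bigr (fun j => c i - c j)) ?divfK ?nz //.
    by move=> j _; rewrite hornerXsubC.
  rewrite hornerZ horner_prod [X in _ * X](bigD1 i) /=; last by rewrite hi eq_sym.
  by rewrite hornerXsubC subrr mul0r mulr0.
have FG : F = G.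
  apply/eqP; rewrite -subr_eq0; apply/eqP.
  apply: (@roots_geq_poly_eq0 _ _ [seq c i | i in D]).
  - apply/allP => y /imageP[i hi ->].
    by rewrite /root hornerD hornerN eG // subrr.
  - by rewrite map_inj_in_uniq ?enum_uniq // => i j; rewrite !mem_enum; apply: cinj.
  - rewrite size_map -cardE (leq_trans (size_polyD _ _)) //.
    by rewrite size_polyN geq_max hF.
rewrite {2}FG /G coef_sum; apply: eq_bigr => i hi.
rewrite coefZ -(sL i hi) -/(lead_coef _) (monicP _) ?mulr1 //.
exact: monic_prod_XsubC.
Qed.

(** * Adding a node *)

Section AddNode.
Variables (R : fieldType) (m n : nat) (q : 'I_m -> R).
Hypothesis hsep : separated n q.
Local Notation row := ('I_m * 'I_n)%type.
Local Notation shp := {ffun row -> nat}.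
Local Notation rowend := (@rowend R m n q).

(** Content of the first node below column [j]. A generalized hook is then a difference of two
    contents, minus 1. *)
Definition colend (la : shp) (t : 'I_m) (j : nat) : R :=
  j%:R - (conjc la t j)%:R + q t.

Lemma hookE (la : shp) (r : row) t j :
  hook q la r.1 t r.2 j (la r) = rowend la r - colend la t j - 1.
Proof. by rewrite /hook /rowend /colend; ring. Qed.

Lemma conjc_add (la : shp) (p : row) t j :
  conjc (add_row la p) t j = (conjc la t j + (t == p.1) * (j == la p))%N.
Proof.
have -> : ((t == p.1) * (j == la p) = \sum_(i < n) ((t, i) == p) * (j == la p))%N.
  rewrite -big_distrl /=; congr (_ * _)%N; case: p => c k; rewrite (bigD1 k) //=.
  rewrite xpair_eqE eqxx andbT big1 ?addn0 // => i /negbTE h.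
  by rewrite xpair_eqE h andbF.
rewrite /conjc -big_split /=; apply: eq_bigr => i _; rewrite ffunE.
case: eqP => [->|_] /=; last by rewrite !addn0.
by rewrite addn1 ltnS leq_eqVlt; case: ltngtP.
Qed.

Lemma conjc_addable (la : shp) (p : row) : partp la -> addable la p -> conjc la p.1 (la p) = p.2.
Proof.
move=> hla /addableP hp; rewrite -[RHS](sum_ltn (ltnW (ltn_ord p.2))).
apply: eq_bigr => i _; congr nat_of_bool; case: (ltnP i p.2) => h; first by rewrite hp.
by apply/negbTE; rewrite -leqNgt {2}[p]surjective_pairing hla.
Qed.

Lemma colend_addable (la : shp) (p : row) : partp la -> addable la p ->
  colend la p.1 (la p) = rowend la p.
Proof. by move=> hla hp; rewrite /colend conjc_addable. Qed.

Lemma hookE_add (la : shp) (p r : row) t j :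
  hook q (add_row la p) r.1 t r.2 j (add_row la p r)
  = rowend la r + (r == p)%:R - colend la t j + ((t == p.1) * (j == la p))%:R - 1.
Proof. by rewrite /hook /rowend /colend conjc_add ffunE !natrD; ring. Qed.

(** The new node raises [rowend] of row [p] by 1 and lowers [colend] of its column by 1. So only the
    factors of row [p] change and, in the other rows, those of column [b] with [t = p.1]. The new
    node itself contributes 1 for [t = p.1]. Denominators are cleared. *)
Lemma hookprod_add (la : shp) (p : row) (c := rowend la p) (b := la p) :
  partp la -> addable la p ->
  hookprod q (add_row la p) * (\prod_(0 <= j < b) \prod_t (c - colend la t j - 1))
    * \prod_(r : row | (b < la r)%N) (rowend la r - c - 1)
  = hookprod q la * (\prod_(t | t != p.1) (c - colend la t b)
    * \prod_(0 <= j < b) \prod_t (c - colend la t j))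
    * \prod_(r : row | (b < la r)%N) (rowend la r - c).
Proof.
move=> hla hp; have E := colend_addable hla hp.
rewrite /hookprod (bigD1 p) //= [in RHS](bigD1 p) //=.
have drop (F : row -> R) : \prod_(r : row | (b < la r)%N) F r
    = \prod_(r | r != p) (if (b < la r)%N then F r else 1).
  by rewrite big_mkcond (bigD1 p) //= ltnn mul1r.
rewrite !drop.
set f' := \prod_(_ <= _ < add_row _ _ _) _.
have -> : f' = (\prod_(0 <= j < b) \prod_t (c - colend la t j))
    * \prod_(t | t != p.1) (c - colend la t b).
  rewrite /f' ffunE eqxx addn1 big_nat_recr //=; congr (_ * _).
    apply: eq_big_nat => j /andP[_ hj]; apply: eq_bigr => t _.
    have := hookE_add la p p t j; rewrite ffunE eqxx addn1 => ->.
    by rewrite (ltn_eqF hj) muln0 /c /=; ring.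
  have H t := hookE_add la p p t b.
  rewrite ffunE eqxx addn1 in H.
  rewrite (bigD1 p.1) //= H !eqxx E -/c /= -[RHS]mul1r; congr (_ * _); first by ring.
  by apply: eq_bigr => t /negbTE ne; rewrite H ne /c /=; ring.
set f := \prod_(0 <= _ < la p) \prod_(_ : _) hook _ _ _ _ _ _ _.
have -> : f = \prod_(0 <= j < b) \prod_t (c - colend la t j - 1).
  by apply: eq_bigr => j _; apply: eq_bigr => t _; rewrite hookE.
set g1 := \prod_(r | r != p) (if _ then _ - 1 else _).
set g2 := \prod_(r | r != p) (if _ then _ else _).
set h1 := \prod_(r | r != p) _; set h2 := \prod_(r | r != p) _.
suff H : h1 * g1 = h2 * g2 by ring: H.
rewrite /h1 /h2 /g1 /g2 -!big_split /=; apply: eq_bigr => r /negbTE ne.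
have HE t j := hookE_add la p r t j; rewrite ffunE ne /= addn0 in HE.
rewrite ffunE ne addn0 !big_mkord.
case: ltnP => hb; last first.
  congr (_ * _); apply: eq_bigr => j _; apply: eq_bigr => t _.
  rewrite HE hookE [_ == la p](_ : _ = false) ?muln0 /=; first by ring.
  by apply/negbTE; rewrite neq_ltn (leq_trans (ltn_ord j)).
rewrite (bigD1 (Ordinal hb)) //= (bigD1 p.1) //= HE !eqxx E -/c.
rewrite [in RHS](bigD1 (Ordinal hb)) //= [in RHS](bigD1 p.1) //= hookE E -/c.
set A1 := \prod_(_ | _) _; set B1 := \prod_(_ | _) _.
set A2 := \prod_(_ | _) _; set B2 := \prod_(_ | _) _.
have -> : A1 = A2.
  by apply: eq_bigr => t /negbTE nt; rewrite HE hookE nt /=; ring.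
have -> : B1 = B2; last by ring.
apply: eq_bigr => j nj; apply: eq_bigr => t _; rewrite HE hookE.
have -> : (j : nat) == la p = false by apply/negbTE; apply: contra nj => /eqP e; apply/eqP/val_inj.
by rewrite muln0 /=; ring.
Qed.

End AddNode.

(** * The ratio of two consecutive hook products *)

Section Ratio.
Variables (R : fieldType) (m n : nat) (q : 'I_m -> R).
Hypothesis hsep : separated n q.
Local Notation row := ('I_m * 'I_n)%type.
Local Notation shp := {ffun row -> nat}.
Local Notation rowend := (@rowend R m n q).
Local Notation colend := (@colend R m n q).

(** Extended by 0 to all indices, since the rim identities number rows by naturals. *)
Definition rowlen (la : shp) (t : 'I_m) (i : nat) : nat :=
  if insub i is Some k then la (t, k) else 0%N.

Lemma rowlenE (la : shp) t (i : 'I_n) : rowlen la t i = la (t, i).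
Proof. by rewrite /rowlen valK. Qed.

Lemma rowlen_out (la : shp) t i : (n <= i)%N -> rowlen la t i = 0%N.
Proof. by move=> h; rewrite /rowlen insubN // -leqNgt. Qed.

Lemma rowlen_mono (la : shp) t i j : partp la -> (i <= j)%N ->
  (rowlen la t j <= rowlen la t i)%N.
Proof.
move=> hla ij; case: (ltnP j n) => jn; last by rewrite rowlen_out.
have hi : (i < n)%N by apply: leq_ltn_trans jn.
by rewrite -[i]/(val (Ordinal hi)) -[j]/(val (Ordinal jn)) !rowlenE hla.
Qed.

Lemma addable_rowlen (la : shp) t (i : 'I_n) : partp la ->
  addable la (t, i) = (val i == 0%N) || (rowlen la t i < rowlen la t i.-1)%N.
Proof.
move=> hla; apply/addableP/idP => /= [h|/orP[/eqP -> //|h] j ji].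
  rewrite -implyNb; apply/implyP => i0.
  have hi : (i.-1 < n)%N by apply: leq_ltn_trans (leq_pred _) (ltn_ord i).
  rewrite rowlenE -[i.-1]/(val (Ordinal hi)) rowlenE; apply: h => /=.
  by rewrite prednK // lt0n.
by rewrite -!rowlenE (leq_trans h) // rowlen_mono //; lia.
Qed.

(** True removability: all later rows of the component are shorter, so for a partition [la] the
    shape [sub_row la p] is again a partition. *)
Definition corner (la : shp) (p : row) : bool :=
  (0 < la p)%N && [forall j : 'I_n, (p.2 < j)%N ==> (la (p.1, j) < la p)%N].

Lemma corner_rowlen (la : shp) t (i : 'I_n) : partp la ->
  corner la (t, i) = (rowlen la t i.+1 < rowlen la t i)%N.
Proof.
move=> hla; apply/andP/idP => /= [[h0 /forallP h]|h].
  rewrite rowlenE; case: (ltnP i.+1 n) => hi; last by rewrite rowlen_out.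
  by have := h (Ordinal hi); rewrite ltnSn -rowlenE.
rewrite -rowlenE; split; first by apply: leq_ltn_trans h.
by apply/forallP => j; apply/implyP => ij; rewrite -rowlenE (leq_ltn_trans _ h) ?rowlen_mono.
Qed.

Lemma conjc_le (la : shp) t j : (conjc la t j <= n)%N.
Proof.
rewrite -[X in (_ <= X)%N](sum_ltn (leqnn n)) /conjc; apply: leq_sum => i _.
by rewrite ltn_ord leq_b1.
Qed.

(** Fewer than n nodes leave an empty row in each component, so all addable positions have a row
    index below n. *)
Lemma conjc0_lt (la : shp) t : (shsize la < n)%N -> (conjc la t 0 < n)%N.
Proof.
apply: leq_ltn_trans; rewrite /conjc -(sum_row_delta t) /shsize; apply: leq_sum => r _.
by case: eqP => [<-|] //=; rewrite -surjective_pairing mul1n; case: (la r).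
Qed.

Lemma rowlen_conjc (la : shp) t i j : partp la ->
  (i < conjc la t j)%N = (j < rowlen la t i)%N.
Proof.
move=> hla; case: (ltnP i n) => hi.
  by rewrite -[i]/(val (Ordinal hi)) rowlenE ltn_conjc.
by rewrite rowlen_out // ltn0 ltnNge (leq_trans (conjc_le _ _ _)).
Qed.

Lemma prod_rows (S : comNzRingType) (P : pred row) (F : row -> S) :
  \prod_(r | P r) F r = \prod_t \prod_(i | P (t, i)) F (t, i).
Proof.
rewrite (pair_big_dep xpredT (fun t i => P (t, i)) (fun t i => F (t, i))) /=.
by apply: eq_big => [[]|[]].
Qed.

(** The product over all components of [rim] at x = 'X - (q t)%:P; the indeterminate makes x
    generic. *)
Lemma rim_shape (la : shp) b : partp la -> (shsize la < n)%N ->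
  (\prod_t \prod_(0 <= j < b.+1) ('X - (colend la t j)%:P))
    * \prod_(r : row | (b < la r)%N) ('X - (rowend la r)%:P)
    * \prod_(r | corner la r) ('X - (rowend la r - 1)%:P)
  = \prod_(r | addable la r) ('X - (rowend la r)%:P)
    * (\prod_t \prod_(0 <= j < b) ('X - (colend la t j + 1)%:P))
    * \prod_(r : row | (b < la r)%N) ('X - (rowend la r - 1)%:P).
Proof.
move=> hla hs; rewrite !prod_rows -!big_split /=; apply: eq_bigr => t _.
pose x : {poly R} := 'X - (q t)%:P.
have xn (c d : nat) : x - c%:R + d%:R != 0.
  have -> : x - c%:R + d%:R = 'X - (q t + c%:R - d%:R)%:P.
    by rewrite /x !rmorphB rmorphD /= !rmorph_nat; ring.
  by rewrite polyXsubC_eq0.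
have := rim (fun i j => rowlen_conjc t i j hla) (conjc0_lt t hs) xn b.
have rE (i : 'I_n) : 'X - (rowend la (t, i))%:P = x - (rowlen la t i)%:R + i%:R.
  by rewrite rowlenE /rowend /x /= rmorphD rmorphB /= !rmorph_nat; ring.
have rE1 (i : 'I_n) : 'X - (rowend la (t, i) - 1)%:P = x - (rowlen la t i)%:R + i%:R + 1.
  by rewrite -rE rmorphB /= rmorph1; ring.
have cE j : 'X - (colend la t j)%:P = x - j%:R + (conjc la t j)%:R.
  by rewrite /colend /x rmorphD rmorphB /= !rmorph_nat; ring.
have cE1 j : 'X - (colend la t j + 1)%:P = x - j%:R + (conjc la t j)%:R - 1.
  by rewrite -cE rmorphD /= rmorph1; ring.
have wid (F : nat -> {poly R}) : \prod_(0 <= i < conjc la t b) F i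
    = \prod_(i < n | (b < la (t, i))%N) F i.
  rewrite big_mkord (big_ord_widen n F (conjc_le la t b)).
  by apply: eq_bigl => i; rewrite rowlen_conjc // rowlenE.
move=> H; rewrite !wid !big_mkord in H.
rewrite (eq_bigr _ (fun j _ => cE j)) (eq_bigr _ (fun j _ => cE1 j)).
rewrite !(eq_bigr _ (fun j _ => rE j)) !(eq_bigr _ (fun j _ => rE1 j)).
rewrite (eq_bigl _ _ (fun i => corner_rowlen t i hla)).
by rewrite (eq_bigl _ _ (fun i => addable_rowlen t i hla)) !big_mkord.
Qed.

(** In [rim_shape] column [b] of component [p.1] and the addable row [p] both contribute 'X - c.
    After cancelling this factor, evaluation at c gives the relation that turns [hookprod_add] into
    the ratio. *)
Lemma hookprod_ratio (la : shp) (p : row) (c := rowend la p) :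
  partp la -> (shsize la < n)%N -> addable la p ->
  hookprod q la / hookprod q (add_row la p)
  = \prod_(r | corner la r) (c - (rowend la r - 1))
    / \prod_(r | addable la r && (r != p)) (c - rowend la r).
Proof.
move=> hla hs hp; set b := la p; have E := colend_addable q hla hp.
have := rim_shape b hla hs.
under eq_bigr do rewrite big_nat_recr //=.
rewrite big_split /= [X in _ * X * _ * _ = _](bigD1 p.1) //= E -/c [X in _ = X * _ * _](bigD1 p) //= -/c.
set P1 := \prod_t _; set P2 := \prod_(t | t != p.1) _.
set P3 := \prod_(r | (b < la r)%N) _; set P4 := \prod_(r | corner la r) _.
set P5 := \prod_(r | addable la r && (r != p)) _; set P6 := \prod_t _.
set P7 := \prod_(r | (b < la r)%N) _ => H.
have {}H : P1 * P2 * P3 * P4 = P5 * P6 * P7.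
  apply: (@mulIf _ ('X - c%:P)); first by rewrite polyXsubC_eq0.
  by transitivity (P1 * (('X - c%:P) * P2) * P3 * P4); [ring|rewrite H; ring].
have {}H := congr1 (horner^~ c) H; move: H.
have ev (I : Type) (r : seq I) (P : pred I) (f : I -> R) :
    (\prod_(i <- r | P i) ('X - (f i)%:P)).[c] = \prod_(i <- r | P i) (c - f i).
  by rewrite horner_prod; apply: eq_bigr => i _; rewrite hornerXsubC.
rewrite !hornerM !ev /P1 /P6 !(horner_prod _ _ (fun t => \prod_(0 <= _ < b) _)).
rewrite !(eq_bigr _ (fun t _ => ev _ _ _ _)) => H.
have := hookprod_add q hla hp; rewrite -/c -/b.
set H1 := hookprod q (add_row la p); set H0 := hookprod q la.
(* The differences over longer rows have opposite signs in [hookprod_add] and in [rim_shape]. The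
   same number of factors changes sign on both sides, so the signs cancel. *)
have opp (a : row -> R) : \prod_(r : row | (b < la r)%N) a r
    = (-1) ^+ #|[pred r : row | (b < la r)%N]| * \prod_(r : row | (b < la r)%N) (- a r).
  by rewrite (prodrN [pred r : row | (b < la r)%N]) mulrA -expr2 sqrr_sign mul1r.
(* By [hookE], this product and the next consist of hook factors of [la], so they can be
   cancelled. *)
have K1 : \prod_(0 <= j < b) \prod_t (c - colend la t j - 1) != 0.
  rewrite prodf_seq_neq0; apply/allP => j; rewrite mem_index_iota => /andP[_ hj].
  by apply/implyP => _; apply/prodf_neq0 => t _; rewrite -hookE hook_neq0 // ltnW.
have K2 : \prod_(r : row | (b < la r)%N) (rowend la r - c - 1) != 0.
  by apply/prodf_neq0 => r hr; rewrite /c -E -hookE hook_neq0 // ltnW.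
have s1 : \prod_(r : row | (b < la r)%N) (rowend la r - c - 1)
    = (-1) ^+ #|[pred r : row | (b < la r)%N]|
      * \prod_(r : row | (b < la r)%N) (c - (rowend la r - 1)).
  by rewrite opp; congr (_ * _); apply: eq_bigr => r _; ring.
have s2 : \prod_(r : row | (b < la r)%N) (rowend la r - c)
    = (-1) ^+ #|[pred r : row | (b < la r)%N]|
      * \prod_(r : row | (b < la r)%N) (c - rowend la r).
  by rewrite opp; congr (_ * _); apply: eq_bigr => r _; ring.
have s3 : \prod_(0 <= j < b) \prod_t (c - colend la t j - 1)
    = \prod_t \prod_(0 <= j < b) (c - (colend la t j + 1)).
  by rewrite exchange_big; apply: eq_bigr => t _; apply: eq_bigr => j _; ring.
rewrite s2 (exchange_big _ _ _ _ _ (fun j t => c - colend la t j)) /= => HA.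
have N1 : H1 != 0.
  by apply: hookprod_neq0 => //; [apply: partp_add|rewrite shsize_add].
have N5 : \prod_(r | addable la r && (r != p)) (c - rowend la r) != 0.
  apply/prodf_neq0 => r /andP[hr ne]; rewrite subr_eq0 /c.
  by apply: (rowend_addable_inj hsep) => //; rewrite eq_sym.
apply/eqP; rewrite eqr_div //; apply/eqP.
apply: (mulIf K2); apply: (mulIf K1); rewrite s1 s3 in HA *.
have alg (Q1 Q2 Q3 Q4 Q5 Q6 Q7 e y z : R) :
    y * Q6 * (e * Q7) = z * (Q2 * Q1) * (e * Q3) -> Q1 * Q2 * Q3 * Q4 = Q5 * Q6 * Q7 ->
    z * Q5 * (e * Q7) * Q6 = Q4 * y * (e * Q7) * Q6.
  move=> h1 h2; transitivity (z * e * (Q5 * Q6 * Q7)); first by ring.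
  rewrite -h2; transitivity (z * (Q2 * Q1) * (e * Q3) * Q4); first by ring.
  rewrite -h1; ring.
exact: alg HA H.
Qed.

(** In each component row 0 is addable, and row i + 1 is addable exactly when row i ends in a
    corner. The last of the n rows is empty, so it has no corner. *)
Lemma card_addable (la : shp) : partp la -> (shsize la < n)%N ->
  #|[pred r | addable la r]| = (m + #|[pred r | corner la r]|)%N.
Proof.
move=> hla hs; rewrite -!sum1_card /=.
have rows (P : pred row) : (\sum_(r in P) 1 = \sum_t \sum_(i | P (t, i)) 1)%N.
  rewrite (pair_big_dep xpredT (fun t i => P (t, i)) (fun t i => 1%N)) /=.
  by apply: eq_bigl => [[]].
rewrite !rows /= -[X in (X + _)%N]card_ord -sum1_card -big_split /=.
apply: eq_bigr => t _.
rewrite (eq_bigl _ _ (fun i => addable_rowlen t i hla)).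
rewrite (eq_bigl _ _ (fun i => corner_rowlen t i hla)).
rewrite -(big_mkord (fun i => (i == 0) || (rowlen la t i < rowlen la t i.-1))%N (fun=> 1%N)).
rewrite -(big_mkord (fun i => (rowlen la t i.+1 < rowlen la t i))%N (fun=> 1%N)).
have hc := conjc0_lt t hs; have l0 i : (n.-1 <= i)%N -> rowlen la t i = 0%N.
  move=> hi; apply/eqP; rewrite eqn0Ngt -rowlen_conjc // -leqNgt; lia.
have n0 : (0 < n)%N by apply: leq_ltn_trans hs.
move: (rowlen la t) l0 => l; case: n n0 => // k _ l0.
rewrite big_mkcond big_nat_recl //= [in RHS]big_mkcond big_nat_recr //=.
rewrite (l0 k.+1) // (l0 k) // ltnn addn0; congr (_ + _)%N.
Qed.

Lemma sum_ratio (la : shp) a : partp la -> (shsize la < n)%N -> (a < m)%N ->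
  \sum_(p | addable la p)
     rowend la p ^+ a * (hookprod q la / hookprod q (add_row la p))
  = (a == m.-1)%:R.
Proof.
move=> hla hs am.
pose F : {poly R} := 'X^a * \prod_(r | corner la r) ('X - (rowend la r - 1)%:P).
have Fm : F \is monic by rewrite monicMl ?monicXn // monic_prod_XsubC.
have hn := card_addable hla hs.
have sF : size F = (a + #|[pred r | corner la r]|).+1.
  rewrite size_monicM ?monicXn ?monic_neq0 ?monic_prod_XsubC //.
  rewrite size_polyXn /= -big_filter size_prod_XsubC size_filter -sum1_count -sum1_card.
  by rewrite addnS.
transitivity (F`_(#|[pred r | addable la r]|.-1)).
  rewrite -(@sum_lagrange R _ [pred r | addable la r] (rowend la)); first last.
  - by rewrite hn sF; lia.
  - move=> r r' hr hr' e; apply/eqP; apply: contra_eqT e => ne.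
    exact: (rowend_addable_inj hsep).
  apply: eq_bigr => p hp; rewrite hookprod_ratio // mulrA; congr (_ / _).
  rewrite /F hornerM hornerXn horner_prod; congr (_ * _).
  by apply: eq_bigr => r _; rewrite hornerXsubC.
rewrite hn; case: eqP => [e|ne].
  by rewrite -[RHS](monicP Fm) /lead_coef sF /= e; congr (_`_ _); lia.
by rewrite nth_default // sF; lia.
Qed.

(** The denominator cancels the factor of [B] in the numerator of the ratio. The degree thus stays
    below the number of addable nodes minus 1 even for a = m - 1. *)
Lemma sum_ratio_corner (la : shp) a (B : row) : partp la -> (shsize la < n)%N ->
  (a < m)%N -> corner la B ->
  (forall p, addable la p -> rowend la p != rowend la B - 1) ->
  \sum_(p | addable la p) rowend la p ^+ a / (rowend la p - (rowend la B - 1))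
     * (hookprod q la / hookprod q (add_row la p)) = 0.
Proof.
move=> hla hs am hB nB.
pose F : {poly R} := 'X^a * \prod_(r | corner la r && (r != B)) ('X - (rowend la r - 1)%:P).
have hn := card_addable hla hs.
have sF : size F = (a + #|[pred r | corner la r]|)%N.
  rewrite size_monicM ?monicXn ?monic_neq0 ?monic_prod_XsubC //.
  rewrite size_polyXn /= -big_filter size_prod_XsubC size_filter -sum1_count.
  have -> : #|[pred r | corner la r]| = (\sum_(r | corner la r && (r != B)) 1).+1.
    rewrite (cardD1 B) inE hB add1n -sum1_card; congr _.+1.
    by apply: eq_bigl => r; rewrite !inE andbC.
  by [].
transitivity (F`_(#|[pred r | addable la r]|.-1)).
  rewrite -(@sum_lagrange R _ [pred r | addable la r] (rowend la)); first last.
  - by rewrite hn sF; lia.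
  - move=> r r' hr hr' e; apply/eqP; apply: contra_eqT e => ne.
    exact: (rowend_addable_inj hsep).
  apply: eq_bigr => p hp; rewrite hookprod_ratio // mulrA; congr (_ / _).
  rewrite /F hornerM hornerXn horner_prod (bigD1 B) //= mulrA divfK ?subr_eq0 ?nB //.
  by congr (_ * _); apply: eq_bigr => r _; rewrite hornerXsubC.
by rewrite nth_default // sF hn; lia.
Qed.

End Ratio.

(** * Jucys--Murphy elements *)

Section Perm.
Variable n : nat.

Definition fixes (r : nat) (w : {perm 'I_n}) : Prop :=
  forall i : 'I_n, (r <= i)%N -> w i = i.

Lemma perm_split (i j : 'I_n) (w : {perm 'I_n}) : (j : nat) = i.+1 ->
  fixes j.+1 w -> w j != j ->
  exists u v, [/\ fixes j u, fixes j v & w = (u * tperm i j * v)%g].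
Proof.
move=> ji hw wj; pose k := (w^-1)%g j.
have wk : w k = j by rewrite permKV.
have kj : k != j by apply: contra wj => /eqP e; rewrite -{1}e wk.
have klt : (k < j)%N.
  rewrite ltnNge leq_eqVlt negb_or eq_sym kj /=; apply/negP => h.
  by move: kj; rewrite -(hw k h) wk eqxx.
have ilt : (i < j)%N by rewrite ji.
(* Products act from the left factor on: [tperm k i] brings k, the preimage of j, to i, the middle
   transposition carries it to j, and the remaining factor fixes j. *)
exists (tperm k i), (tperm i j * tperm k i * w)%g.
have hu : fixes j (tperm k i).
  by move=> l hl; rewrite tpermD // neq_ltn (leq_trans _ hl) ?orbT.
split=> //; last first.
  by rewrite !mulgA -(mulgA (tperm k i)) tperm2 mulg1 tperm2 mul1g.
move=> l hl; rewrite !permM; case: (eqVneq l j) => [->|ne].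
  by rewrite tpermR tpermR wk.
rewrite (tpermD (z := l)); last by rewrite eq_sym.
  by rewrite hu // hw // ltn_neqAle hl andbT eq_sym.
by rewrite neq_ltn (leq_trans ilt hl).
Qed.

Lemma perm_gen_ind r (P : {perm 'I_n} -> Prop) : (r <= n)%N ->
  P 1%g -> (forall u v, P u -> P v -> P (u * v)%g) ->
  (forall i j : 'I_n, (j : nat) = i.+1 -> (j < r)%N -> P (tperm i j)) ->
  forall w, fixes r w -> P w.
Proof.
move=> hr P1 PM; elim: r hr => [|r IH] hr Pt w hw.
  by have -> : w = 1%g by apply/permP => i; rewrite perm1 hw.
have IH' : forall w, fixes r w -> P w.
  by apply: IH => [|i j ji jr]; [exact: ltnW | apply: Pt => //; apply: ltnW].
pose j := Ordinal hr; case: (eqVneq (w j) j) => wj.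
  apply: IH' => i; rewrite leq_eqVlt => /orP[/eqP e|]; last exact: hw.
  by have -> : i = j by apply: val_inj.
have [r0|r0] := posnP r.
  have e : w (w j) = w j.
    apply: hw; rewrite r0 lt0n; apply: contra wj => /eqP e0.
    by apply/eqP/val_inj; rewrite /= e0 r0.
  by move: wj; rewrite -{2}(perm_inj e) eqxx.
have hi : (r.-1 < n)%N by apply: leq_ltn_trans (leq_pred _) hr.
have ji : (j : nat) = (Ordinal hi).+1 by rewrite /= prednK.
have [u [v [hu hv ->]]] := perm_split ji hw wj.
by apply: (PM); [apply: (PM); [apply: (IH') | exact: Pt] | exact: IH'].
Qed.

End Perm.

Section Span.
Variables (R : nzRingType) (A : lmodType R).

(** The generating families are infinite, with all exponents allowed, and properties are proved by
    induction on a linear combination. *)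
Inductive lspan (G : A -> Prop) : A -> Prop :=
| lspan0 : lspan G 0
| lspanZD k a b : G a -> lspan G b -> lspan G (k *: a + b).

Lemma lspan_gen (G : A -> Prop) a : G a -> lspan G a.
Proof. by move=> h; rewrite -[a]addr0 -[a]scale1r; apply: lspanZD => //; apply: lspan0. Qed.

Lemma lspanD (G : A -> Prop) a b : lspan G a -> lspan G b -> lspan G (a + b).
Proof.
move=> ha hb; elim: ha => [|k c d hc _ IH]; first by rewrite add0r.
by rewrite -addrA; apply: lspanZD.
Qed.

Lemma lspanZ (G : A -> Prop) k a : lspan G a -> lspan G (k *: a).
Proof.
elim=> [|l c d hc _ IH]; first by rewrite scaler0; apply: lspan0.
by rewrite scalerDr scalerA; apply: lspanZD.
Qed.

End Span.

Lemma lspan_map (R : nzRingType) (A B : lmodType R) (G : A -> Prop) (G' : B -> Prop)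
    (f : A -> B) : (forall k a b, f (k *: a + b) = k *: f a + f b) ->
  (forall a, G a -> lspan G' (f a)) -> forall a, lspan G a -> lspan G' (f a).
Proof.
move=> lf h a; have f0 : f 0 = 0.
  by have := lf (-1) 0 0; rewrite scaler0 addr0 scaleN1r addNr.
elim=> [|k b c hb _ IH]; first by rewrite f0; apply: lspan0.
by rewrite lf; apply: lspanD => //; apply: lspanZ; apply: h.
Qed.

(** * Commutation relations and subalgebras in the Hecke algebra *)

Section Hecke.
Variables (R : fieldType) (m n : nat) (q : 'I_m -> R) (A : falgType R).
Variables (s : nat -> A) (g : {perm 'I_n} -> A).
Hypothesis hrel : hecke_rel n q s.
Hypothesis g1 : g 1%g = 1.
Hypothesis gt : forall i j : 'I_n, (j : nat) = i.+1 -> g (tperm i j) = s j.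
Hypothesis gM : forall u v, g (u * v)%g = g u * g v.
Local Notation x := (jm s).

Lemma s_sq i : (0 < i < n)%N -> s i * s i = 1.
Proof. by case: hrel => _ _ + _ _; apply. Qed.

Lemma s_jmS k : (k.+1 < n)%N -> s k.+1 * x k.+1 = x k * s k.+1 + 1.
Proof. by move=> h; rewrite /= mulrDr !mulrA s_sq // mul1r. Qed.

Lemma s_jm k : (k.+1 < n)%N -> s k.+1 * x k = x k.+1 * s k.+1 - 1.
Proof. by move=> h; rewrite /= mulrDl -!mulrA s_sq // mulr1 addrK. Qed.

Lemma comm_sandwich (a y z : A) :
  a * z = z * a -> a * y = y * a -> a * (z * y * z + z) = (z * y * z + z) * a.
Proof.
move=> h1 h2; rewrite mulrDr mulrDl !mulrA h1 -(mulrA z a) h2 mulrA.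
by rewrite -(mulrA (z * y)) h1 mulrA.
Qed.

Lemma s_jm_far i k : (k.+1 < i)%N -> (i < n)%N -> s i * x k = x k * s i.
Proof.
have [_ _ _ _ hc] := hrel.
elim: k => [|k IH] ki hi /=; first by apply: hc => //; lia.
have c1 : s i * s k.+1 = s k.+1 * s i by apply: hc => //; lia.
by apply: comm_sandwich => //; apply: IH => //; lia.
Qed.

(** Only k = i + 1 needs the braid relation, after expanding [x k] down to [x i.-1]. For larger k,
    [s i] commutes with both [s k] and [x k.-1]. *)
Lemma s_jm_near i k : (0 < i)%N -> (i < k)%N -> (k < n)%N -> s i * x k = x k * s i.
Proof.
have [_ _ _ hb hc] := hrel.
move=> i0; elim: k => [|k IH] // ik hk; move: ik; rewrite ltnS leq_eqVlt => /orP[/eqP e|ik].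
  case: i e i0 {IH} => // i e _; rewrite -e /=; rewrite -e in hk.
  have c1 : s i.+2 * x i = x i * s i.+2 by apply: s_jm_far.
  have b1 : s i.+1 * s i.+2 * s i.+1 = s i.+2 * s i.+1 * s i.+2 by apply: hb.
  have q1 : s i.+1 * s i.+1 = 1 by apply: s_sq; lia.
  have q2 : s i.+2 * s i.+2 = 1 by apply: s_sq; lia.
  set a := s i.+1 in b1 q1 *; set b := s i.+2 in c1 b1 q2 *; set y := x i in c1 *.
  rewrite !(mulrDr, mulrDl) !mulrA.
  have E1 : a * b * a * y * a * b = b * a * y * a * b * a.
    transitivity (b * a * (b * y) * a * b); first by rewrite b1 !mulrA.
    rewrite c1; transitivity (b * a * y * (b * a * b)); first by rewrite !mulrA.
    by rewrite -b1 !mulrA.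
  have E2 : a * b * a * b = b * a by rewrite b1 -mulrA q2 mulr1.
  have E3 : b * a * b * a = a * b by rewrite -b1 -mulrA q1 mulr1.
  by rewrite E1 E2 E3 -!addrA (addrC (b * a)).
have c1 : s i * s k.+1 = s k.+1 * s i by apply: hc; lia.
have c2 : s i * x k = x k * s i by apply: IH => //; lia.
exact: comm_sandwich.
Qed.

Lemma s0_jm k : (0 < k)%N -> (k < n)%N -> s 0 * x k = x k * s 0.
Proof.
have [_ h1 _ _ hc] := hrel.
case: k => // k _; elim: k => [|k IH] hk; first by apply: h1.
have c1 : s 0 * s k.+2 = s k.+2 * s 0 by apply: hc; lia.
have c2 : s 0 * x k.+1 = x k.+1 * s 0 by apply: IH; lia.
exact: comm_sandwich.
Qed.

(** Stands in for the subalgebra generated by s_0, ..., s_(r-1), which it contains; as a centralizer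
    it is visibly closed under the operations. *)
Definition jmcomm (r : nat) (a : A) : Prop :=
  forall k, (r <= k < n)%N -> a * x k = x k * a.

Lemma jmcomm1 r : jmcomm r 1.
Proof. by move=> k _; rewrite mulr1 mul1r. Qed.

Lemma jmcommM r a b : jmcomm r a -> jmcomm r b -> jmcomm r (a * b).
Proof. by move=> ha hb k hk; rewrite -mulrA hb // mulrA ha // mulrA. Qed.

Lemma jmcommD r a b : jmcomm r a -> jmcomm r b -> jmcomm r (a + b).
Proof. by move=> ha hb k hk; rewrite mulrDl mulrDr ha // hb. Qed.

Lemma jmcommZ r c a : jmcomm r a -> jmcomm r (c *: a).
Proof. by move=> ha k hk; rewrite -scalerAl -scalerAr ha. Qed.

Lemma jmcommX r a e : jmcomm r a -> jmcomm r (a ^+ e).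
Proof.
by move=> ha; elim: e => [|e IH]; [exact: jmcomm1 | rewrite exprS; apply: jmcommM].
Qed.

Lemma jmcomm_le r r' a : (r <= r')%N -> jmcomm r a -> jmcomm r' a.
Proof. by move=> rr ha k /andP[h1 h2]; apply: ha; rewrite h2 andbT (leq_trans rr). Qed.

Lemma jmcomm_s r j : (j < r)%N -> jmcomm r (s j).
Proof.
move=> jr k /andP[rk kn]; case: j jr => [|j] jr; first by apply: s0_jm => //; lia.
by apply: s_jm_near => //; lia.
Qed.

Lemma jmcomm_jm r j : (j < r)%N -> jmcomm r (x j).
Proof.
elim: j => [|j IH] jr; first exact: jmcomm_s.
by apply: jmcommD; [apply: jmcommM; [apply: jmcommM|]|];
  try exact: jmcomm_s; apply: IH; lia.
Qed.

Lemma jmcomm_g r w : (r <= n)%N -> fixes r w -> jmcomm r (g w).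
Proof.
move=> hr; move: w; apply: perm_gen_ind => //.
- by rewrite g1; apply: jmcomm1.
- by move=> u v hu hv; rewrite gM; apply: jmcommM.
- by move=> i j ji jr; rewrite gt //; apply: jmcomm_s.
Qed.

Definition xmon (r : nat) (e : nat -> nat) : A := \prod_(k < r) x k ^+ e k.

Lemma xmonS r e : xmon r.+1 e = xmon r e * x r ^+ e r.
Proof. exact: big_ord_recr. Qed.

Lemma eq_xmon r e e' : (forall k, (k < r)%N -> e k = e' k) -> xmon r e = xmon r e'.
Proof. by move=> h; apply: eq_bigr => k _; rewrite h. Qed.

Lemma jmcomm_xmon r e : jmcomm r (xmon r e).
Proof.
elim: r => [|r IH]; first by rewrite /xmon big_ord0; apply: jmcomm1.
rewrite xmonS; apply: jmcommM; first exact: jmcomm_le IH.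
by apply: jmcommX; apply: jmcomm_jm.
Qed.

Lemma jm_xmon r k e : (k < r)%N -> (r <= n)%N ->
  x k * xmon r e = xmon r (fun i => (i == k) + e i)%N.
Proof.
elim: r => // r IH; rewrite ltnS leq_eqVlt => /orP[/eqP->|kr] hr.
  rewrite !xmonS mulrA -(jmcomm_xmon e) ?leqnn // eqxx exprS mulrA.
  by congr (_ * _ * _); apply: eq_xmon => i ir; rewrite (ltn_eqF ir).
by rewrite !xmonS mulrA IH ?(ltnW hr) // (gtn_eqF kr).
Qed.

Definition xpol (r : nat) : A -> Prop := lspan (fun a => exists e, a = xmon r e).

(** The r-th subalgebra through its monomials. With unbounded exponents, multiplying by [x k] never
    requires reducing a power. *)
Definition xgspan (r : nat) : A -> Prop :=
  lspan (fun a => exists e w, fixes r w /\ a = xmon r e * g w).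

Lemma lmul_linear (y : A) k a b : y * (k *: a + b) = k *: (y * a) + y * b.
Proof. by rewrite mulrDr scalerAr. Qed.

Lemma xpol_jm r k a : (k < r)%N -> (r <= n)%N -> xpol r a -> xpol r (x k * a).
Proof.
move=> kr hr; apply: lspan_map; first exact: lmul_linear.
by move=> _ [e ->]; apply: lspan_gen; rewrite jm_xmon //; eexists.
Qed.

Lemma xmon_ind r e (P : A -> Prop) : P 1 ->
  (forall k y, (k < r)%N -> P y -> P (x k * y)) -> P (xmon r e).
Proof.
move=> P1 PM; rewrite -[xmon r e]mulr1.
suff H r' y : (r' <= r)%N -> P y -> P (xmon r' e * y) by apply: H.
elim: r' y => [|r' IH] y hr hy; first by rewrite /xmon big_ord0 mul1r.
rewrite xmonS -mulrA; apply: IH; first exact: ltnW.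
by elim: (e r') => [|d IHd]; rewrite ?mul1r // exprS -mulrA; apply: PM.
Qed.

Lemma xpol1 r : xpol r 1.
Proof. by apply: lspan_gen; exists (fun=> 0%N); rewrite /xmon big1. Qed.

(** [s j] moves past one Jucys--Murphy factor at a time, exchanging [x j] and [x j.-1] at the cost
    of a constant. *)
Lemma s_xmon r j e : (0 < j)%N -> (j < r)%N -> (r <= n)%N ->
  exists f f', [/\ xpol r f, xpol r f' & s j * xmon r e = f * s j + f'].
Proof.
move=> j0 jr hr.
(* Membership of the monomial in [xpol r] is carried along because the constant terms bring it into
   the remainder. *)
suff [] : xpol r (xmon r e) /\
  exists f f', [/\ xpol r f, xpol r f' & s j * xmon r e = f * s j + f'] by [].
pattern (xmon r e); apply: xmon_ind.
  split; first exact: xpol1.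
  exists 1, 0; split; [exact: xpol1|exact: lspan0|by rewrite mul1r mulr1 addr0].
move=> k y kr [hy [f [f' [hf hf' E]]]]; split; first exact: xpol_jm.
case: j j0 jr E => // j _ jr E.
case: (eqVneq k j.+1) => [->|kj1].
  exists (x j * f), (x j * f' + y); split.
  - by apply: xpol_jm => //; lia.
  - by apply: lspanD => //; apply: xpol_jm => //; lia.
  by rewrite mulrA s_jmS ?mulrDl ?mul1r -?mulrA ?E ?mulrDr ?mulrA ?addrA //; lia.
case: (eqVneq k j) => [->|kj].
  exists (x j.+1 * f), (x j.+1 * f' - y); split.
  - by apply: xpol_jm.
  - apply: lspanD; first by apply: xpol_jm.
    by rewrite -scaleN1r; apply: lspanZ.
  rewrite mulrA s_jm; last exact: leq_trans jr hr.
  by rewrite mulrDl mulN1r -(mulrA (x j.+1)) E mulrDr !mulrA addrA.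
exists (x k * f), (x k * f'); split; try by apply: xpol_jm.
have c : s j.+1 * x k = x k * s j.+1.
  have jn := leq_trans jr hr; have kn := leq_trans kr hr.
  case: (ltngtP k j) => [h|h|ekj]; [exact: s_jm_far| |by rewrite ekj eqxx in kj].
  by apply: s_jm_near => //; rewrite ltn_neqAle eq_sym kj1.
by rewrite mulrA c -mulrA E mulrDr !mulrA.
Qed.

Lemma xpol_g r f w : xpol r f -> fixes r w -> xgspan r (f * g w).
Proof.
move=> hf hw; move: f hf; apply: lspan_map; first by move=> k a b; rewrite mulrDl scalerAl.
by move=> _ [e ->]; apply: lspan_gen; exists e, w.
Qed.

Lemma xgspan_jm r k a : (k < r)%N -> (r <= n)%N -> xgspan r a -> xgspan r (x k * a).
Proof.
move=> kr hr; apply: lspan_map; first exact: lmul_linear.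
move=> _ [e [w [hw ->]]]; rewrite mulrA; apply: xpol_g => //; apply: xpol_jm => //.
by apply: lspan_gen; exists e.
Qed.

Lemma xgspan_g r w a : (r <= n)%N -> fixes r w -> xgspan r a -> xgspan r (g w * a).
Proof.
move=> hr hw; move: w hw a.
apply: (perm_gen_ind (P := fun w => forall a, xgspan r a -> xgspan r (g w * a))) => //.
- by move=> a; rewrite g1 mul1r.
- by move=> u v hu hv a ha; rewrite gM -mulrA; apply: hu; apply: hv.
move=> i j ji jr; apply: lspan_map; first exact: lmul_linear.
move=> _ [e [w [hw ->]]]; rewrite gt // mulrA.
have [|f [f' [hf hf' ->]]] := s_xmon e _ jr hr; first by rewrite ji.
rewrite mulrDl -mulrA -(gt ji) -gM; apply: lspanD; apply: xpol_g => //.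
move=> l hl; rewrite permM tpermD ?hw // neq_ltn (leq_trans _ hl) //.
by rewrite -ji ltnW.
Qed.

Lemma jmcomm_xgspan r a : (r <= n)%N -> xgspan r a -> jmcomm r a.
Proof.
move=> hr; elim=> [|k b c [e [w [hw ->]]] _ IH].
  by move=> k _; rewrite mulr0 mul0r.
apply: jmcommD => //; apply: jmcommZ; apply: jmcommM; first exact: jmcomm_xmon.
exact: jmcomm_g.
Qed.

End Hecke.

(** * Weight representations *)

Lemma interpolation (R : fieldType) (c : seq R) (phi : R -> R) :
  exists f : {poly R}, {in c, forall z, f.[z] = phi z}.
Proof.
elim: c => [|y c [f hf]]; first by exists 0.
have [yc|yc] := boolP (y \in c).
  by exists f => z; rewrite inE => /orP[/eqP->|]; apply: hf.
pose P : {poly R} := \prod_(z <- c) ('X - z%:P).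
have Py : P.[y] != 0 by rewrite -/(root P y) root_prod_XsubC.
exists (f + ((phi y - f.[y]) / P.[y]) *: P) => z.
rewrite inE hornerD hornerZ => /orP[/eqP->|zc]; first by rewrite divfK // addrC subrK.
have -> : P.[z] = 0 by apply/eqP; rewrite -/(root P z) root_prod_XsubC.
by rewrite mulr0 addr0 hf.
Qed.

Section Rep.
Variables (R : fieldType) (m n : nat) (q : 'I_m -> R) (A : falgType R).
Variables (s : nat -> A) (g : {perm 'I_n} -> A).
Hypothesis hsep : separated n q.
Hypothesis hrel : hecke_rel n q s.
Hypothesis g1 : g 1%g = 1.
Hypothesis gt : forall i j : 'I_n, (j : nat) = i.+1 -> g (tperm i j) = s j.
Hypothesis gM : forall u v, g (u * v)%g = g u * g v.
Local Notation x := (jm s).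
Local Notation row := ('I_m * 'I_n)%type.
Local Notation shp := {ffun row -> nat}.
Local Notation rowend := (@rowend R m n q).
Local Notation jmcomm := (@jmcomm R n A s).
Local Notation xgspan := (@xgspan R n A s g).
Local Notation fixes := (@fixes n).

Definition wordsof (r : nat) (la : shp) : seq (seq row) :=
  [seq T <- lwords m n r | wshape T == la].

(** The head of [p :: Y'] is entry number [size Y'], counted from 0; beyond the word 0 is a default
    value. *)
Fixpoint wcont (Y : seq row) (k : nat) : R :=
  if Y is p :: Y' then
    if k == size Y' then rowend (wshape Y') p else wcont Y' k
  else 0.

(* Multiplicativity is required only on the elements commuting with x_r, ..., x_(n-1):
   these preserve the last node, so a block of such a representation is again one. *)
Definition wrep (r : nat) (la : shp) (pi : A -> seq row -> seq row -> R) : Prop :=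
  [/\ forall T U, T \in wordsof r la -> U \in wordsof r la -> pi 1 T U = (T == U)%:R,
      forall a b, jmcomm r a -> jmcomm r b ->
        forall T U, T \in wordsof r la -> U \in wordsof r la ->
        pi (a * b) T U = \sum_(V <- wordsof r la) pi a T V * pi b V U,
      forall k a b T U, pi (k *: a + b) T U = k * pi a T U + pi b T U
    & forall k T U, (k < r)%N -> T \in wordsof r la -> U \in wordsof r la ->
        pi (x k) T U = (T == U)%:R * wcont T k].

Lemma mem_wordsof r la Y :
  (Y \in wordsof r la) = [&& wshape Y == la, size Y == r & lword Y].
Proof. by rewrite mem_filter mem_lwords. Qed.

Lemma wordsof_uniq r la : uniq (wordsof r la).
Proof. by rewrite filter_uniq // lwords_uniq. Qed.

Lemma mem_wordsof_cons r la p Y : addable la p ->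
  Y \in wordsof r la -> p :: Y \in wordsof r.+1 (add_row la p).
Proof.
by move=> ha; rewrite !mem_wordsof /= shape_cons eqSS => /and3P[/eqP -> -> ->]; rewrite eqxx ha.
Qed.

Lemma wordsof_consP r la T : T \in wordsof r.+1 la -> exists p Y,
  [/\ T = p :: Y, addable (wshape Y) p, la = add_row (wshape Y) p & Y \in wordsof r (wshape Y)].
Proof.
rewrite mem_wordsof; case: T => [|p Y] /=; first by rewrite andbF.
rewrite shape_cons eqSS => /and4P[/eqP <- hs ha hY]; exists p, Y; split=> //.
by rewrite mem_wordsof eqxx hs.
Qed.

Lemma wordsof_part r la T : T \in wordsof r la -> partp la /\ shsize la = r.
Proof.
rewrite mem_wordsof => /and3P[/eqP <- /eqP <- hT]; split; last exact: shsize_shape.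
exact: partp_shape.
Qed.

Lemma wcont_last p Y : wcont (p :: Y) (size Y) = rowend (wshape Y) p.
Proof. by rewrite /= eqxx. Qed.

Lemma wcont_cons p Y k : (k < size Y)%N -> wcont (p :: Y) k = wcont Y k.
Proof. by move=> h /=; rewrite (ltn_eqF h). Qed.

(** Words grow one letter at a time, and distinct addable rows of one shape have distinct
    contents. *)
Lemma wcont_inj r T U : (r <= n)%N -> T \in lwords m n r -> U \in lwords m n r ->
  (forall k, (k < r)%N -> wcont T k = wcont U k) -> T = U.
Proof.
elim: r T U => [|r IH] [|p T] [|p' U] hr; rewrite !mem_lwords //=.
rewrite !eqSS => /and3P[/eqP sT aT hT] /and3P[/eqP sU aU hU] h.
have E : T = U.
  apply: IH; rewrite ?mem_lwords ?sT ?sU ?hT ?hU ?eqxx ?(ltnW hr) // => k kr.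
  by have := h k (ltnW kr); rewrite sT sU (ltn_eqF kr).
rewrite -{}E in sU aU hU h *; congr (_ :: _); apply/eqP.
have := h r (ltnSn r); rewrite sT eqxx => e; apply: contra_eqT e => ne.
by apply: (rowend_addable_inj hsep) => //; [apply: partp_shape | rewrite shsize_shape sT].
Qed.

Lemma sum_wordsof_delta r la (F : seq row -> R) U : U \in wordsof r la ->
  \sum_(V <- wordsof r la) F V * (V == U)%:R = F U.
Proof.
move=> hU; rewrite (bigD1_seq U) ?wordsof_uniq //= eqxx mulr1 big1 ?addr0 //.
by move=> V /negbTE ->; rewrite mulr0.
Qed.

Lemma sum_wordsof_blocks r la (F G : seq row -> R) :
  (forall p mu, partp mu -> shsize mu = r -> addable mu p -> la = add_row mu p ->
     \sum_(Y <- wordsof r mu) F (p :: Y) = \sum_(Y <- wordsof r mu) G (p :: Y)) ->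
  \sum_(T <- wordsof r.+1 la) F T = \sum_(T <- wordsof r.+1 la) G T.
Proof.
move=> h; rewrite !big_filter !big_lwords_shape; apply: eq_bigr => p /andP[hp ha].
rewrite -[LHS]big_filter -[RHS]big_filter -/(wordsof r (sub_row la p)).
have := @wordsof_part r (sub_row la p).
have := h p (sub_row la p).
(* If [sub_row la p] is not a partition, it has no words and both sums are empty; otherwise any word
   certifies the hypotheses on [mu]. *)
case: (wordsof r (sub_row la p)) => [|Y l] H W; first by rewrite !big_nil.
have [|hm hs] := W Y; first by rewrite inE eqxx.
by apply: H => //; rewrite sub_rowK.
Qed.

Section One.
Variables (r : nat) (la : shp) (pi : A -> seq row -> seq row -> R).
Hypothesis hpi : wrep r la pi.

Lemma wrep_jmr a k T U : jmcomm r a -> (k < r)%N -> T \in wordsof r la ->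
  U \in wordsof r la -> pi (a * x k) T U = pi a T U * wcont U k.
Proof.
case: hpi => _ pM _ pX ha kr hT hU; rewrite pM //; last exact: (jmcomm_jm hrel).
rewrite -(sum_wordsof_delta (fun V => pi a T V * wcont U k) hU).
rewrite !big_seq; apply: eq_bigr => V hV; rewrite pX //.
by case: eqP => [->|_]; rewrite ?mul1r ?mulr1 // mul0r !mulr0.
Qed.

Lemma wrep_jml a k T U : jmcomm r a -> (k < r)%N -> T \in wordsof r la ->
  U \in wordsof r la -> pi (x k * a) T U = wcont T k * pi a T U.
Proof.
case: hpi => _ pM _ pX ha kr hT hU; rewrite pM //; last exact: (jmcomm_jm hrel).
rewrite -(sum_wordsof_delta (fun V => wcont T k * pi a V U) hT).
rewrite !big_seq; apply: eq_bigr => V hV; rewrite pX //.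
by case: eqP => [->|ne]; rewrite ?eqxx ?mul1r ?mulr1 // !mul0r eq_sym; case: eqP => // _; rewrite mulr0.
Qed.

Lemma wrep_jmXr a k e T U : jmcomm r a -> (k < r)%N -> T \in wordsof r la ->
  U \in wordsof r la -> pi (a * x k ^+ e) T U = pi a T U * wcont U k ^+ e.
Proof.
move=> ha kr hT hU; elim: e => [|e IH]; first by rewrite !mulr1.
rewrite exprSr mulrA wrep_jmr // ?IH ?exprSr ?mulrA //.
by apply: jmcommM => //; apply: jmcommX; apply: (jmcomm_jm hrel).
Qed.

Lemma wrep_jmXl a k e T U : jmcomm r a -> (k < r)%N -> T \in wordsof r la ->
  U \in wordsof r la -> pi (x k ^+ e * a) T U = wcont T k ^+ e * pi a T U.
Proof.
move=> ha kr hT hU; elim: e => [|e IH]; first by rewrite !mul1r.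
rewrite exprS -mulrA wrep_jml // ?IH ?exprS ?mulrA //.
by apply: jmcommM => //; apply: jmcommX; apply: (jmcomm_jm hrel).
Qed.

(** An element commuting with [x k] preserves its eigenspaces. *)
Lemma wrep_offdiag a k T U : jmcomm r a -> (k < r)%N -> T \in wordsof r la ->
  U \in wordsof r la -> a * x k = x k * a -> wcont T k != wcont U k -> pi a T U = 0.
Proof.
move=> ha kr hT hU c ne; have := wrep_jmr ha kr hT hU; rewrite c wrep_jml // => E.
apply/eqP; have : (wcont T k - wcont U k) * pi a T U == 0.
  by rewrite mulrBl E [wcont U k * _]mulrC subrr.
by rewrite mulf_eq0 subr_eq0 (negbTE ne).
Qed.

Lemma wrep_trC a b : jmcomm r a -> jmcomm r b ->
  \sum_(T <- wordsof r la) pi (a * b) T T = \sum_(T <- wordsof r la) pi (b * a) T T.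
Proof.
case: hpi => _ pM _ _ ha hb.
rewrite big_seq (eq_bigr (fun T => \sum_(V <- wordsof r la) pi a T V * pi b V T));
  last by move=> T hT; apply: pM.
rewrite [RHS]big_seq [RHS](eq_bigr (fun T => \sum_(V <- wordsof r la) pi b T V * pi a V T));
  last by move=> T hT; apply: pM.
rewrite -!big_seq exchange_big /=; apply: eq_bigr => T _; apply: eq_bigr => V _.
exact: mulrC.
Qed.

End One.

(** [a] commutes with [x r], whose eigenvalue is the content of the last node, and the ends of
    different strippable rows have different contents. *)
Lemma wrep_head r la pi a p p' T U : (r < n)%N -> wrep r.+1 la pi -> jmcomm r a ->
  p :: T \in wordsof r.+1 la -> p' :: U \in wordsof r.+1 la -> p != p' ->
  pi a (p :: T) (p' :: U) = 0.
Proof.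
move=> hr hpi ha hT hU ne.
apply: (wrep_offdiag hpi (k := r)) => //; first by apply: jmcomm_le ha.
  by apply: ha; rewrite leqnn.
have [hla hs] := wordsof_part hT.
move: hT hU; rewrite !mem_wordsof !shape_cons /= !eqSS.
move=> /and4P[/eqP eT /eqP sT aT lT] /and4P[/eqP eU /eqP sU aU lU].
rewrite sT sU eqxx.
have eT' : wshape T = sub_row la p by rewrite -eT add_rowK.
have eU' : wshape U = sub_row la p' by rewrite -eU add_rowK.
have sp : strippable la p.
  by have := add_row_eq la (wshape T) p; rewrite aT eT eqxx => /esym /andP[].
have sp' : strippable la p'.
  by have := add_row_eq la (wshape U) p'; rewrite aU eU eqxx => /esym /andP[].
by rewrite eT' eU'; apply: (rowend_strippable_inj hsep); rewrite ?hs.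
Qed.

Lemma wrep_restrict r la pi p : (r < n)%N -> addable la p ->
  wrep r.+1 (add_row la p) pi -> wrep r la (fun a T U => pi a (p :: T) (p :: U)).
Proof.
move=> hr ha hpi; have [p1 pM pL pX] := hpi.
have inc T : T \in wordsof r la -> p :: T \in wordsof r.+1 (add_row la p).
  exact: mem_wordsof_cons.
split=> [T U hT hU|a b hca hcb T U hT hU|k a b T U|k T U kr hT hU].
- by rewrite p1 ?inc // eqseq_cons eqxx.
- rewrite pM ?inc //; try by apply: jmcomm_le; last eassumption.
  (* By [wrep_head], intermediate words with another head contribute nothing to the matrix
     product. *)
  rewrite big_filter big_lwords_shape (bigD1 p) /=; last first.
    by have := add_row_eq (add_row la p) la p; rewrite ha eqxx => /esym /andP[].
  rewrite add_rowK -big_filter -/(wordsof r la) [X in _ + X]big1 ?addr0 // => p' /andP[sp ne].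
  rewrite -big_filter big_seq big1 // => Y hY.
  rewrite (wrep_head hr hpi hca) ?mul0r ?inc // 1?eq_sym //.
  have [hp' ha'] := andP sp.
  by rewrite -(sub_rowK hp'); apply: mem_wordsof_cons.
- exact: pL.
- rewrite pX ?inc ?ltnS ?(ltnW kr) // eqseq_cons eqxx /=.
  by move: hT; rewrite mem_wordsof => /and3P[_ /eqP -> _]; rewrite (ltn_eqF kr).
Qed.

(** The diagonal entry of s_(r+1) x_(r+1) = x_r s_(r+1) + 1, with x numbered from 0. It also shows
    that the last two contents of a word differ. *)
Lemma wrep_s_diag r la pi T : (r.+1 < n)%N -> wrep r.+2 la pi ->
  T \in wordsof r.+2 la -> pi (s r.+1) T T * (wcont T r.+1 - wcont T r) = 1.
Proof.
move=> hr hpi hT; have [p1 pM pL pX] := hpi.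
have hs : jmcomm r.+2 (s r.+1) by apply: (jmcomm_s hrel).
rewrite mulrBr -(wrep_jmr hpi) // (s_jmS hrel) // -[x r * _]scale1r pL mul1r (wrep_jml hpi) //.
by rewrite p1 // eqxx [pi _ _ _ * _]mulrC addrAC subrr add0r.
Qed.

(** [s r.+1] commutes with [x k] for k < r, so a nonzero entry forces equal contents, hence equal
    letters, at the first r places. With the head and the shape fixed, the remaining letter agrees
    as well. *)
Lemma wrep_s_block r la pi p T U : (r.+1 < n)%N -> wrep r.+2 la pi ->
  p :: T \in wordsof r.+2 la -> p :: U \in wordsof r.+2 la -> T != U ->
  pi (s r.+1) (p :: T) (p :: U) = 0.
Proof.
move=> hr hpi hT hU ne.
have hs : jmcomm r.+2 (s r.+1) by apply: (jmcomm_s hrel).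
have [/forallP h|] := boolP [forall k : 'I_r, wcont (p :: T) k == wcont (p :: U) k]; last first.
  rewrite negb_forall => /existsP[k hk].
  apply: (wrep_offdiag hpi (k := k)) => //; first by rewrite ltnW // ltnS ltnW // ltnS.
  by apply: (s_jm_far hrel) => //; rewrite ltnS.
case/negP: ne; apply/eqP; move: hT hU h; rewrite !mem_wordsof !shape_cons.
case: T => [|B T]; case: U => [|B' U] /=; rewrite ?andbF // !eqSS.
move=> /and5P[/eqP eT /eqP sT aT bT lT] /and5P[/eqP eU /eqP sU aU bU lU] h.
have E : T = U.
  apply: (@wcont_inj r); rewrite ?mem_lwords ?sT ?sU ?eqxx ?lT ?lU //; first by rewrite ltnW // ltnW.
  move=> k kr; have /eqP := h (Ordinal kr); rewrite /= sT sU.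
  by rewrite (ltn_eqF kr) (ltn_eqF (ltnW (kr : (k.+1 < r.+1)%N))).
rewrite E in eT *; congr (_ :: _); apply/eqP.
have := congr1 (fun f : shp => sub_row f p B) (etrans eT (esym eU)).
rewrite !add_rowK !shape_cons !ffunE eqxx => /eqP; rewrite eqn_add2l.
by case: (B =P B').
Qed.

End Rep.

(** * Characters of weight representations *)

Section Characters.
Variables (R : fieldType) (m n : nat) (q : 'I_m -> R) (A : falgType R).
Variables (s : nat -> A) (g : {perm 'I_n} -> A).
Hypothesis hsep : separated n q.
Hypothesis hrel : hecke_rel n q s.
Hypothesis g1 : g 1%g = 1.
Hypothesis gt : forall i j : 'I_n, (j : nat) = i.+1 -> g (tperm i j) = s j.
Hypothesis gM : forall u v, g (u * v)%g = g u * g v.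
Local Notation x := (jm s).
Local Notation row := ('I_m * 'I_n)%type.
Local Notation shp := {ffun row -> nat}.
Local Notation rowend := (@rowend R m n q).
Local Notation jmcomm := (@jmcomm R n A s).
Local Notation xgspan := (@xgspan R n A s g).
Local Notation xmon := (@xmon R A s).
Local Notation fixes := (@fixes n).
Local Notation wordsof := (@wordsof m n).
Local Notation wcont := (@wcont R m n q).
Local Notation wrep := (@wrep R m n q A s).

Lemma tr_fixed r la pi e w : (r < n)%N -> wrep r.+1 la pi -> fixes r w ->
  \sum_(T <- wordsof r.+1 la) pi (xmon r.+1 e * g w) T T
  = \sum_(T <- wordsof r.+1 la) pi (xmon r e * g w) T T * wcont T r ^+ e r.
Proof.
move=> hr hpi hw; have hg : jmcomm r (g w) by apply: (jmcomm_g hrel g1 gt gM) => //; apply: ltnW.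
have hx := @jmcomm_xmon _ _ _ _ _ _ hrel r e.
have -> : xmon r.+1 e * g w = xmon r e * g w * x r ^+ e r.
  rewrite xmonS -!mulrA; congr (_ * _).
  elim: (e r) => [|d IH]; first by rewrite mul1r mulr1.
  by rewrite exprS -mulrA IH !mulrA (hg r) // leqnn.
rewrite !big_seq; apply: eq_bigr => T hT.
rewrite (wrep_jmXr hrel hpi) //.
by apply: (@jmcomm_le _ _ _ _ r) => //; apply: jmcommM.
Qed.

(** Cyclicity of the trace collects all factors except x_(r+1)^d s_(r+1) into one element preserving
    the head. In a block with fixed head s_(r+1) is diagonal, so only diagonal entries
    contribute. *)
Lemma tr_moved r la pi e (i j : 'I_n) u v : (r.+1 < n)%N -> wrep r.+2 la pi ->
  (i : nat) = r -> (j : nat) = r.+1 -> fixes r.+1 u -> fixes r.+1 v ->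
  \sum_(T <- wordsof r.+2 la) pi (xmon r.+2 e * g (u * tperm i j * v)%g) T T
  = \sum_(T <- wordsof r.+2 la) pi (g v * (xmon r.+1 e * g u)) T T
      * (wcont T r.+1 ^+ e r.+1 / (wcont T r.+1 - wcont T r)).
Proof.
move=> hr hpi ir jr hu hv; have [_ pM _ _] := hpi.
have hgu : jmcomm r.+1 (g u) by apply: (jmcomm_g hrel g1 gt gM) => //; apply: ltnW.
have hgv : jmcomm r.+1 (g v) by apply: (jmcomm_g hrel g1 gt gM) => //; apply: ltnW.
have hx := @jmcomm_xmon _ _ _ _ _ _ hrel r.+1 e.
have hs : jmcomm r.+2 (s r.+1) by apply: (jmcomm_s hrel).
have le a : jmcomm r.+1 a -> jmcomm r.+2 a by apply: jmcomm_le.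
have hX d : jmcomm r.+2 (x r.+1 ^+ d) by apply: jmcommX; apply: (jmcomm_jm hrel).
have hvu : jmcomm r.+1 (g v * (xmon r.+1 e * g u)) by do 2 apply: jmcommM => //.
have -> : xmon r.+2 e * g (u * tperm i j * v)%g
    = (xmon r.+1 e * g u) * (x r.+1 ^+ e r.+1 * s r.+1) * g v.
  rewrite xmonS !gM gt ?jr ?ir // !mulrA; congr (_ * _ * _); rewrite -!mulrA; congr (_ * _).
  elim: (e r.+1) => [|d IH]; first by rewrite mul1r mulr1.
  by rewrite exprS -mulrA IH !mulrA (hgu r.+1) // leqnn.
rewrite (wrep_trC hpi); first last.
- exact: le.
- by apply: jmcommM; [apply: le; apply: jmcommM | apply: jmcommM].
rewrite mulrA !big_seq; apply: eq_bigr => T hT.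
rewrite pM //; [|exact: le|exact: jmcommM].
set h := g v * _; set c := _ / _.
have D := wrep_s_diag hrel hr hpi hT.
have Dn : wcont T r.+1 - wcont T r != 0.
  by apply: contra_eq_neq D => ->; rewrite mulr0 eq_sym oner_neq0.
have E : pi (x r.+1 ^+ e r.+1 * s r.+1) T T = c.
  rewrite (wrep_jmXl hrel hpi) //; congr (_ * _).
  by apply: (mulIf Dn); rewrite D mulVf.
rewrite -E -[RHS](sum_wordsof_delta (fun V => pi h T V * _) hT).
rewrite !big_seq; apply: eq_bigr => V hV; case: (V =P T) => [->|/eqP ne]; rewrite ?mulr1 // mulr0.
have [p [Y [eT _ _ _]]] := wordsof_consP hT.
have [p' [Z [eV _ _ _]]] := wordsof_consP hV.
rewrite eT eV in hT hV ne *.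
have [pp|pp] := eqVneq p p'; last by rewrite (wrep_head hsep hrel hr hpi) ?mul0r.
rewrite -pp in hV ne *; rewrite (wrep_jmXl hrel hpi) // (wrep_s_block hsep hrel hr hpi) ?mulr0 //.
by apply: contra ne => /eqP ->.
Qed.

(** Only finitely many values of [phi] matter, so [phi] may be taken to be a polynomial. Evaluated
    at [x r] and multiplied into [h], it leaves a combination of ordinary characters. *)
Lemma sum_interpolated r mu pi pi' (phi : R -> R) h : (r < n)%N ->
  wrep r.+1 mu pi -> wrep r.+1 mu pi' -> xgspan r.+1 h ->
  (forall a, xgspan r.+1 a -> \sum_(Y <- wordsof r.+1 mu) pi a Y Y
                             = \sum_(Y <- wordsof r.+1 mu) pi' a Y Y) ->
  \sum_(Y <- wordsof r.+1 mu) pi h Y Y * phi (wcont Y r)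
  = \sum_(Y <- wordsof r.+1 mu) pi' h Y Y * phi (wcont Y r).
Proof.
move=> hr hpi hpi' hh H.
have [f hf] := interpolation [seq wcont Y r | Y <- wordsof r.+1 mu] phi.
have hc : jmcomm r.+1 h by apply: (jmcomm_xgspan hrel g1 gt gM).
have main rho : wrep r.+1 mu rho -> \sum_(Y <- wordsof r.+1 mu) rho h Y Y * phi (wcont Y r)
    = \sum_(i < size f) f`_i * \sum_(Y <- wordsof r.+1 mu) rho (x r ^+ i * h) Y Y.
  move=> hrho; under [RHS]eq_bigr do rewrite mulr_sumr.
  rewrite exchange_big /= !big_seq; apply: eq_bigr => Y hY.
  have <- : f.[wcont Y r] = phi (wcont Y r) by apply: hf; apply: map_f.
  rewrite horner_coef mulr_sumr; apply: eq_bigr => i _.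
  by rewrite (wrep_jmXl hrel hrho) // mulrCA; congr (_ * _); rewrite mulrC.
rewrite !main //; apply: eq_bigr => i _; rewrite H //.
elim: (nat_of_ord i) => [|d IH]; first by rewrite mul1r.
by rewrite exprS -mulrA; apply: (xgspan_jm hrel).
Qed.

Lemma fixes_step r (hr : (r < n)%N) (w : {perm 'I_n}) :
  fixes r.+1 w -> w (Ordinal hr) = Ordinal hr -> fixes r w.
Proof.
move=> hw e i; rewrite leq_eqVlt => /orP[/eqP ri|]; last exact: hw.
by have -> : i = Ordinal hr by apply: val_inj.
Qed.

Lemma fixes1 (hn : (0 < n)%N) (w : {perm 'I_n}) : fixes 1 w -> w (Ordinal hn) = Ordinal hn.
Proof.
move=> hw; have [//|ne] := eqVneq (w (Ordinal hn)) (Ordinal hn).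
have e : w (w (Ordinal hn)) = w (Ordinal hn).
  apply: hw; rewrite lt0n; apply: contra ne => /eqP e0; exact/eqP/val_inj.
exact: perm_inj e.
Qed.

(** The case split behind both inductions on r. That [w] is not 1 is recorded because the trace form
    must then vanish. *)
Variant last_moved_spec (r : nat) (w : {perm 'I_n}) : Prop :=
| LastFixed of fixes r w
| LastMoved r' (i j : 'I_n) u v of r = r'.+1 & (i : nat) = r' & (j : nat) = r'.+1
    & fixes r u & fixes r v & w = (u * tperm i j * v)%g & w != 1%g.

Lemma last_movedP r w : (r < n)%N -> fixes r.+1 w -> last_moved_spec r w.
Proof.
move=> hr hw; have [e|ne] := eqVneq (w (Ordinal hr)) (Ordinal hr).
  by apply: LastFixed; apply: fixes_step e.
case: r hr hw ne => [|r] hr hw ne; first by rewrite fixes1 ?eqxx in ne.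
have hi : (r < n)%N by apply: ltnW.
have [u [v [hu hv e]]] := @perm_split n (Ordinal hi) (Ordinal hr) w erefl hw ne.
apply: (@LastMoved _ _ r (Ordinal hi) (Ordinal hr) u v) => //.
by apply: contra ne => /eqP ->; rewrite perm1.
Qed.

Lemma wrep_character r la pi pi' h : (r <= n)%N -> wrep r la pi -> wrep r la pi' ->
  xgspan r h ->
  \sum_(T <- wordsof r la) pi h T T = \sum_(T <- wordsof r la) pi' h T T.
Proof.
elim: r la pi pi' h => [|r IH] la pi pi' h hr hpi hpi'.
all: have [p1 _ pL _] := hpi; have [p1' _ pL' _] := hpi'.
(* Linearity with scalar -1 at 0 reads rho 0 = - rho 0 + rho 0. *)
all: have z0 rho : (forall k a b T U, rho (k *: a + b) T U = k * rho a T U + rho b T U) ->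
    forall T U : seq row, rho 0 T U = 0 :> R
  by move=> hL T U; have := hL (-1) 0 0 T U; rewrite scaler0 addr0 mulN1r addNr.
all: elim=> [|k a b [e [w [hw ->]]] _ IHb];
  first by rewrite !big1 // => T _; rewrite z0.
all: under eq_bigr do rewrite pL.
all: under [RHS]eq_bigr do rewrite pL'.
all: rewrite !big_split /= -!mulr_sumr IHb; congr (_ * _ + _).
  have -> : w = 1%g by apply/permP => i; rewrite perm1 hw.
  rewrite g1 mulr1 /xmon big_ord0 !big_seq; apply: eq_bigr => T hT.
  by rewrite p1 // p1'.
have hrl := ltnW hr.
case: (last_movedP hr hw) => [hw'|r' i j u v er ei ej hu hv ew _].
  rewrite !tr_fixed //; apply: sum_wordsof_blocks => p mu hmu hs ha ela.
  rewrite !big_seq (eq_bigr (fun Y => pi (xmon r e * g w) (p :: Y) (p :: Y) * rowend mu p ^+ e r)).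
    rewrite [RHS](eq_bigr (fun Y => pi' (xmon r e * g w) (p :: Y) (p :: Y) * rowend mu p ^+ e r)).
      rewrite -!big_seq -!mulr_suml; congr (_ * _).
      rewrite ela in hpi hpi'.
      have := IH mu _ _ (xmon r e * g w) hrl (wrep_restrict hsep hrel hr ha hpi)
        (wrep_restrict hsep hrel hr ha hpi').
      by apply; apply: lspan_gen; exists e, w.
    by move=> Y; rewrite mem_wordsof => /and3P[/eqP <- /eqP <- _]; rewrite wcont_last.
  by move=> Y; rewrite mem_wordsof => /and3P[/eqP <- /eqP <- _]; rewrite wcont_last.
subst r; rewrite ew !(tr_moved _ hr) //; apply: sum_wordsof_blocks => p mu hmu hs ha ela.
set hv0 := g v * _; set d := e r'.+1.
(* Once the head [p] is fixed, the weight depends only on the content [y] of the entry before it. *)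
pose phi y := rowend mu p ^+ d / (rowend mu p - y).
have fold rho : \sum_(Y <- wordsof r'.+1 mu) rho hv0 (p :: Y) (p :: Y)
     * (wcont (p :: Y) r'.+1 ^+ d / (wcont (p :: Y) r'.+1 - wcont (p :: Y) r'))
   = \sum_(Y <- wordsof r'.+1 mu) rho hv0 (p :: Y) (p :: Y) * phi (wcont Y r').
  rewrite !big_seq; apply: eq_bigr => Y; rewrite mem_wordsof => /and3P[/eqP eY /eqP sY _].
  by rewrite /phi -{1 2}sY wcont_last wcont_cons ?sY // eY.
rewrite !fold; rewrite ela in hpi hpi'.
have Hpi := wrep_restrict hsep hrel hr ha hpi.
have Hpi' := wrep_restrict hsep hrel hr ha hpi'.
apply: (sum_interpolated phi hrl Hpi Hpi'); last by move=> c hc; exact: (IH _ _ _ _ hrl Hpi Hpi' hc).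
apply: (xgspan_g hrel g1 gt gM) => //; apply: lspan_gen; by exists e, u.
Qed.

Lemma sum_lwords_by_shape r (F G : shp -> seq row -> R) :
  (forall la, partp la -> shsize la = r ->
     \sum_(T <- wordsof r la) F la T = \sum_(T <- wordsof r la) G la T) ->
  \sum_(T <- lwords m n r) F (wshape T) T = \sum_(T <- lwords m n r) G (wshape T) T.
Proof.
move=> h; apply: eq_sum_by_shape => la.
rewrite (eq_bigr (F la)); last by move=> T /eqP ->.
rewrite [RHS](eq_bigr (G la)); last by move=> T /eqP ->.
rewrite -[LHS]big_filter -[RHS]big_filter -/(wordsof r la).
have := h la; have := @wordsof_part _ _ r la.
case: (wordsof r la) => [|T l] H W; first by rewrite !big_nil.
by have [|hla hs] := H T; [rewrite inE eqxx | apply: W].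
Qed.

Lemma corner_cons (B : row) Y : lword (B :: Y) -> corner (wshape (B :: Y)) B.
Proof.
move=> /= /andP[hB /partp_shape hY]; rewrite shape_cons /corner ffunE eqxx addn1 /=.
apply/forallP => j; apply/implyP => ij; rewrite !ffunE.
have -> : (B.1, j) == B = false.
  by apply/negbTE/negP => /eqP e; move: ij; rewrite -{1}e /= ltnn.
rewrite addn0 ltnS; have := hY B.1 _ _ (ltnW ij).
by rewrite -surjective_pairing !ffunE.
Qed.

Lemma rowend_cons (B : row) Y : rowend (wshape (B :: Y)) B - 1 = rowend (wshape Y) B.
Proof. by rewrite shape_cons /rowend ffunE eqxx natrD /=; ring. Qed.

(** * The weighted sum of characters on monomials *)

Section Trace.
Variable p0 : row.
Hypothesis hp0 : p0.2 = 0%N :> nat.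

Lemma addable_p0 la : addable la p0.
Proof. by apply/addableP => j; rewrite hp0. Qed.

(** The row [p0] is addable to every shape, so its block serves as a common reference. Replacing the
    block of each head [p] by it leaves only scalars under the sum over [p]. *)
Lemma sum_addable r (pi : shp -> A -> seq row -> seq row -> R) h (psi : seq row -> R) :
  (forall mu p, partp mu -> shsize mu = r -> addable mu p ->
     \sum_(Y <- wordsof r mu) pi (add_row mu p) h (p :: Y) (p :: Y) * psi (p :: Y)
     = \sum_(Y <- wordsof r mu) pi (add_row mu p0) h (p0 :: Y) (p0 :: Y) * psi (p :: Y)) ->
  \sum_(T <- lwords m n r.+1) pi (wshape T) h T T * psi T / hookprod q (wshape T)
  = \sum_(Y <- lwords m n r) pi (add_row (wshape Y) p0) h (p0 :: Y) (p0 :: Y)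
      * \sum_(p | addable (wshape Y) p) psi (p :: Y) / hookprod q (add_row (wshape Y) p).
Proof.
move=> H; rewrite big_lwords.
pose F mu Y := \sum_(p | addable mu p)
  pi (add_row mu p) h (p :: Y) (p :: Y) * psi (p :: Y) / hookprod q (add_row mu p).
pose G mu Y := pi (add_row mu p0) h (p0 :: Y) (p0 :: Y)
      * \sum_(p | addable mu p) psi (p :: Y) / hookprod q (add_row mu p).
rewrite (eq_bigr (fun Y => F (wshape Y) Y)); last first.
  move=> Y _; rewrite /F; apply: eq_big => [p|p _]; first by rewrite andbT.
  by rewrite shape_cons.
rewrite [RHS](eq_bigr (fun Y => G (wshape Y) Y)) //.
apply: sum_lwords_by_shape => mu hmu hs; rewrite /F /G.
under [RHS]eq_bigr do rewrite mulr_sumr.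
rewrite exchange_big [RHS]exchange_big /=; apply: eq_bigr => p hp.
under [RHS]eq_bigr do rewrite mulrA.
by rewrite -!mulr_suml H.
Qed.

Lemma wrep_trace r (pi : shp -> A -> seq row -> seq row -> R) e w : (r <= n)%N ->
  (forall la, partp la -> shsize la = r -> wrep r la (pi la)) ->
  (forall k, (k < r)%N -> (e k < m)%N) -> fixes r w ->
  \sum_(T <- lwords m n r) pi (wshape T) (xmon r e * g w) T T / hookprod q (wshape T)
  = ((w == 1%g) && all (fun k => e k == m.-1) (iota 0 r))%:R.
Proof.
elim: r pi w => [|r IH] pi w hr hpi he hw.
  have -> : w = 1%g by apply/permP => i; rewrite perm1 hw.
  rewrite big_seq1 g1 mulr1 /xmon big_ord0 eqxx /=.
  have T0 : [::] \in wordsof 0 (wshape [::]) by rewrite mem_wordsof /= eqxx.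
  have [h1 h2] := wordsof_part T0; have [-> //] := hpi _ h1 h2.
  rewrite eqxx /hookprod big1 ?divr1 // => p _; rewrite ffunE big_geq //.
have hrl := ltnW hr.
have part_add (mu : shp) p : partp mu -> shsize mu = r -> addable mu p ->
    partp (add_row mu p) /\ shsize (add_row mu p) = r.+1.
  by move=> h1 h2 h3; split; [apply: partp_add | rewrite shsize_add h2].
have res (mu : shp) p : partp mu -> shsize mu = r -> addable mu p ->
    wrep r mu (fun a T U => pi (add_row mu p) a (p :: T) (p :: U)).
  move=> h1 h2 h3; apply: (wrep_restrict hsep hrel) => //.
  by have [h4 h5] := part_add _ _ h1 h2 h3; apply: hpi.
have szY (Y : seq row) : Y \in lwords m n r -> size Y = r /\ lword Y.
  by rewrite mem_lwords => /andP[/eqP -> ->].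
case: (last_movedP hr hw) => [hw'|r' i j u v er ei ej hu hv ew wn].
  transitivity (\sum_(T <- lwords m n r.+1)
      pi (wshape T) (xmon r e * g w) T T * wcont T r ^+ e r / hookprod q (wshape T)).
    apply: (sum_lwords_by_shape
      (F := fun la T => pi la (xmon r.+1 e * g w) T T / hookprod q la)
      (G := fun la T => pi la (xmon r e * g w) T T * wcont T r ^+ e r / hookprod q la)).
    by move=> la hla hs; rewrite -!mulr_suml tr_fixed //; apply: hpi.
  rewrite (sum_addable (psi := fun T => wcont T r ^+ e r)); last first.
    move=> mu p hmu hs ha.
    have E (rho : seq row -> R) : \sum_(Y <- wordsof r mu) rho Y * wcont (p :: Y) r ^+ e r
        = (\sum_(Y <- wordsof r mu) rho Y) * rowend mu p ^+ e r.
      rewrite mulr_suml !big_seq; apply: eq_bigr => Y.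
      by rewrite mem_wordsof => /and3P[/eqP <- /eqP <- _]; rewrite wcont_last.
    rewrite !E; congr (_ * _).
    apply: (wrep_character (h := xmon r e * g w) hrl (res _ _ hmu hs ha)
      (res _ _ hmu hs (addable_p0 mu))).
    by apply: lspan_gen; exists e, w.
  (* [sum_ratio] evaluates the sum over [p] and restores the inverse hook product of the smaller
     shape. The induction hypothesis then applies to the blocks with head [p0]. *)
  rewrite big_seq (eq_bigr (fun Y =>
    pi (add_row (wshape Y) p0) (xmon r e * g w) (p0 :: Y) (p0 :: Y) / hookprod q (wshape Y)
    * (e r == m.-1)%:R)); last first.
    move=> Y /szY[sY lY]; rewrite -mulrA; congr (_ * _).
    have hm := partp_shape lY; have hs : (shsize (wshape Y) < n)%N by rewrite shsize_shape sY.
    rewrite -(sum_ratio hsep hm hs (he r (ltnSn r))) mulr_sumr; apply: eq_bigr => p hp.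
    rewrite -{1}sY wcont_last mulrCA; congr (_ * _).
    by rewrite mulKf // hookprod_neq0 // ltnW.
  rewrite -big_seq -mulr_suml.
  have -> := IH (fun mu a T U => pi (add_row mu p0) a (p0 :: T) (p0 :: U)) w hrl.
  - rewrite -[in RHS]addn1 iotaD all_cat /= add0n andbT andbA -natrM mulnb //.
  - by move=> mu hmu hs; apply: res => //; apply: addable_p0.
  - by move=> k kr; apply: he; apply: ltnW.
  - by [].
subst r; rewrite (negbTE wn) andFb.
set hvu := g v * (xmon r'.+1 e * g u).
pose d := e r'.+1; pose psi T := wcont T r'.+1 ^+ d / (wcont T r'.+1 - wcont T r').
transitivity (\sum_(T <- lwords m n r'.+2)
    pi (wshape T) hvu T T * psi T / hookprod q (wshape T)).
  apply: (sum_lwords_by_shape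
    (F := fun la T => pi la (xmon r'.+2 e * g w) T T / hookprod q la)
    (G := fun la T => pi la hvu T T * psi T / hookprod q la)).
  by move=> la hla hs; rewrite -!mulr_suml ew (tr_moved _ hr) //; apply: hpi.
rewrite sum_addable; last first.
  move=> mu p hmu hs ha.
  pose phi y := rowend mu p ^+ d / (rowend mu p - y).
  have E (rho : seq row -> R) : \sum_(Y <- wordsof r'.+1 mu) rho Y * psi (p :: Y)
      = \sum_(Y <- wordsof r'.+1 mu) rho Y * phi (wcont Y r').
    rewrite !big_seq; apply: eq_bigr => Y; rewrite mem_wordsof => /and3P[/eqP eY /eqP sY _].
    by rewrite /psi /phi -{1 2}sY wcont_last wcont_cons ?sY // eY.
  rewrite !E.
  have W1 := res _ _ hmu hs ha; have W0 := res _ _ hmu hs (addable_p0 mu).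
  apply: (sum_interpolated (h := hvu) phi hrl W1 W0).
    by apply: (xgspan_g hrel g1 gt gM) => //; apply: lspan_gen; exists e, u.
  by move=> a ha'; apply: (wrep_character hrl W1 W0 ha').
(* When the last letter is moved, the sum over [p] vanishes for each [Y] separately, by
   [sum_ratio_corner] at the head [B] of [Y]. *)
rewrite big_seq big1 // => Y hY; have [sY lY] := szY _ hY.
rewrite [X in _ * X](_ : _ = 0) ?mulr0 //.
have hm := partp_shape lY; have hs : (shsize (wshape Y) < n)%N by rewrite shsize_shape sY.
case: Y sY lY hm hs hY => // B Y sY lY hm hs hY.
have hc := corner_cons lY.
have cB : wcont (B :: Y) r' = rowend (wshape (B :: Y)) B - 1.
  by case: sY => <-; rewrite wcont_last rowend_cons.
have cp p : wcont (p :: B :: Y) r'.+1 = rowend (wshape (B :: Y)) p.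
  by rewrite -sY wcont_last.
have cp' p : wcont (p :: B :: Y) r' = rowend (wshape (B :: Y)) B - 1.
  by rewrite wcont_cons ?sY.
(* This follows from the representation: by [wrep_s_diag] the last two contents of [p :: B :: Y]
   differ. *)
have nB p : addable (wshape (B :: Y)) p ->
    rowend (wshape (B :: Y)) p != rowend (wshape (B :: Y)) B - 1.
  move=> hp; rewrite -subr_eq0 -cp -(cp' p).
  have [hm' hs'] := part_add _ _ hm (etrans (shsize_shape _) sY) hp.
  have hT : p :: B :: Y \in wordsof r'.+2 (add_row (wshape (B :: Y)) p).
    by rewrite -shape_cons mem_wordsof eqxx; case: sY => <-; rewrite eqxx /= hp.
  have D := wrep_s_diag hrel hr (hpi _ hm' hs') hT.
  by apply: contra_eq_neq D => ->; rewrite mulr0 eq_sym oner_neq0.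
apply: (mulfI (hookprod_neq0 hsep hm (ltnW hs))); rewrite mulr0.
rewrite -[RHS](sum_ratio_corner hsep hm hs (he r'.+1 (ltnSn _)) hc nB).
by rewrite mulr_sumr; apply: eq_bigr => p hp; rewrite /psi cp cp' mulrCA.
Qed.

End Trace.

End Characters.

(** * Standard tableaux as lattice words *)

Section WordOfFun.
Variables (R : fieldType) (m n : nat) (q : 'I_m -> R).
Local Notation row := ('I_m * 'I_n)%type.
Local Notation shp := {ffun row -> nat}.
Implicit Types f : 'I_n -> row.

(** Reversed because the head of a word is its latest letter. *)
Definition fword f (k : nat) : seq row := rev (take k [seq f l | l <- enum 'I_n]).
Definition cntf f (k : nat) (p : row) : nat := #|[set l : 'I_n | (l < k)%N && (f l == p)]|.

Lemma size_fenum f : size [seq f l | l <- enum 'I_n] = n.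
Proof. by rewrite size_map size_enum_ord. Qed.

Lemma fwordS f (k : 'I_n) : fword f k.+1 = f k :: fword f k.
Proof.
rewrite /fword (take_nth (f k)) ?size_fenum // rev_rcons.
by rewrite (nth_map k) ?size_enum_ord // nth_ord_enum.
Qed.

Lemma size_fword f k : (k <= n)%N -> size (fword f k) = k.
Proof. by move=> h; rewrite size_rev size_takel // size_fenum. Qed.

Lemma cntfS f (k : 'I_n) p : cntf f k.+1 p = ((f k == p) + cntf f k p)%N.
Proof.
rewrite /cntf (cardsD1 k) inE ltnSn /=; congr (_ + _)%N; apply: eq_card => l.
rewrite !inE ltnS leq_eqVlt; case: (eqVneq l k) => [->|ne] /=; first by rewrite ltnn.
by rewrite (inj_eq val_inj) (negbTE ne).
Qed.

Lemma wshape_fword f k : (k <= n)%N -> wshape (fword f k) = [ffun p => cntf f k p].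
Proof.
move=> hk; apply/ffunP => p; rewrite !ffunE.
elim: k hk => [|k IH] hk; last by rewrite (fwordS f (Ordinal hk)) /= IH ?(ltnW hk) // (cntfS f (Ordinal hk)).
by rewrite /fword take0 /cntf (_ : finset _ = set0) ?cards0 //; apply/setP => l; rewrite !inE.
Qed.

Lemma cntf_mono f k k' p : (k <= k')%N -> (cntf f k p <= cntf f k' p)%N.
Proof.
move=> h; apply: subset_leq_card; apply/subsetP => l; rewrite !inE => /andP[lk ->].
by rewrite (leq_trans lk).
Qed.

Lemma lword_fwordP f :
  reflect (forall k : 'I_n, addable (wshape (fword f k)) (f k)) (lword (fword f n)).
Proof.
have H k : (k <= n)%N -> reflect (forall l : 'I_n, (l < k)%N ->
    addable (wshape (fword f l)) (f l)) (lword (fword f k)).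
  elim: k => [|k IH] hk; first by rewrite /fword take0; constructor.
  rewrite (fwordS f (Ordinal hk)) /=; apply: (iffP andP) => [[h1 /(IH (ltnW hk)) h2] l|h].
    rewrite ltnS leq_eqVlt => /orP[/eqP e|]; last exact: h2.
    by have -> : l = Ordinal hk by apply: val_inj.
  by split; [apply: (h (Ordinal hk)) | apply/(IH (ltnW hk)) => l lk; apply: h; apply: ltnW].
by apply: (iffP (H n (leqnn n))) => h l; [apply: h | move=> _; apply: h].
Qed.

Lemma wcont_fword f k' (k : 'I_n) : (k < k')%N -> (k' <= n)%N ->
  wcont q (fword f k') k = rowend q (wshape (fword f k)) (f k).
Proof.
elim: k' => // k' IH; rewrite ltnS => kk hk; rewrite (fwordS f (Ordinal hk)) /=.
rewrite size_fword ?(ltnW hk) //; move: kk; rewrite leq_eqVlt; case: eqP => [e _|_] /=.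
  by have -> : Ordinal hk = k by [apply: val_inj]; rewrite e.
by move=> kk; apply: IH => //; apply: ltnW.
Qed.

Lemma fword_inj f f' : fword f n = fword f' n -> f =1 f'.
Proof.
rewrite /fword => /(can_inj revK); rewrite !take_oversize ?size_fenum //.
by move=> /eq_in_map h k; apply: h; rewrite mem_enum.
Qed.

Lemma fword_surj (Y : seq row) : size Y = n -> exists f, Y = fword f n.
Proof.
case: Y => [|p Y] sY.
  (* An empty word means n = 0; there may then be no row to use as the default of [nth]. *)
  have h (k : 'I_n) : False by have := ltn_ord k; rewrite -{2}sY.
  exists (fun k => match h k with end).
  by rewrite /fword take_oversize ?size_fenum //; case: (enum _).
exists (fun k => nth p (rev (p :: Y)) k); rewrite /fword.
rewrite take_oversize ?size_fenum // -[LHS]revK; congr rev.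
apply: (@eq_from_nth _ p); first by rewrite size_rev sY size_fenum.
move=> i; rewrite size_rev sY => hi; rewrite (nth_map (Ordinal hi)) ?size_enum_ord //.
by rewrite -[i in RHS]/(val (Ordinal hi)) nth_ord_enum.
Qed.

End WordOfFun.

(** * The correspondence between standard tableaux and words *)

Section Tableaux.
Variables (R : fieldType) (m n : nat) (q : 'I_m -> R).
Local Notation row := ('I_m * 'I_n)%type.
Local Notation shp := {ffun row -> nat}.

Definition shp_of (lam : MP m n) : shp := [ffun p => (lam p.1 p.2 : nat)].
(** [inord] is faithful for rows of length at most n, as in all shapes with at most n nodes. *)
Definition mp_of (la : shp) : MP m n := [ffun c => [ffun i => inord (la (c, i))]].

Lemma shp_ofK lam : mp_of (shp_of lam) = lam.
Proof. by apply/ffunP => c; apply/ffunP => i; rewrite !ffunE /= inord_val. Qed.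

Lemma mp_ofK (la : shp) : (shsize la <= n)%N -> shp_of (mp_of la) = la.
Proof.
move=> h; apply/ffunP => p; rewrite !ffunE inordK -?surjective_pairing // ltnS.
by apply: leq_trans h; rewrite /shsize (bigD1 p) //= leq_addr.
Qed.

Lemma mpartP lam : reflect (partp (shp_of lam) /\ shsize (shp_of lam) = n) (mpart lam).
Proof.
have E : shsize (shp_of lam) = (\sum_(c < m) \sum_(i < n) (lam c i : nat))%N.
  by rewrite /shsize pair_bigA /=; apply: eq_bigr => p _; rewrite ffunE.
apply: (iffP andP) => [[/forallP h /eqP h']|[h h']]; split; rewrite ?E //.
- move=> c i j ij; rewrite !ffunE /=.
  by have /forallP /(_ i) /forallP /(_ j) /implyP := h c; apply.
- apply/forallP => c; apply/forallP => i; apply/forallP => j; apply/implyP => ij.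
  by have := h c i j ij; rewrite !ffunE.
- by rewrite -E h'.
Qed.

Lemma hookprod_schur1 lam : hookprod q (shp_of lam) = schur1 q lam.
Proof.
rewrite /schur1 pair_bigA /=; apply: eq_bigr => p _.
rewrite big_mkord ffunE (big_ord_widen n (fun j => \prod_t hook q _ p.1 t p.2 j _)); last first.
  by rewrite -ltnS.
apply: eq_bigr => j hj; apply: eq_bigr => t _; rewrite /hook /ghook.
have -> : conjp lam t j = conjc (shp_of lam) t j.
  rewrite /conjp -sum1dep_card /conjc big_mkcond; apply: eq_bigr => i _.
  by rewrite ffunE; case: (_ < _)%N.
by rewrite !rmorphD !rmorphN /= rmorph1 -!pmulrn -!natr1; ring.
Qed.

Definition tabrow (T : tableau m n) (k : 'I_n) : row := ((T k).2, (T k).1.1).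

Section Std.
Variables (lam : MP m n) (T : tableau m n).
Hypothesis hlam : mpart lam.
Hypothesis hT : standard lam T.
Let f := tabrow T.

Lemma std_inj : injective T.
Proof. by have /and5P[/injectiveP] := hT. Qed.

Lemma std_node k : is_node lam (T k).
Proof. by have /and5P[_ /forallP] := hT. Qed.

Lemma std_codom y : is_node lam y -> exists k, T k = y.
Proof.
have /and5P[_ _ /forallP h _ _] := hT; move=> hy; have := h y; rewrite hy /= => /codomP[k ->].
by exists k.
Qed.

Lemma std_row k k' : f k = f k' -> ((T k).1.2 < (T k').1.2)%N -> (k < k')%N.
Proof.
have /and5P[_ _ _ /forallP h _] := hT; move=> [e1 e2] lt.
by have /forallP /(_ k') := h k; rewrite e1 e2 !eqxx lt.
Qed.

Lemma std_col k k' : (T k).2 = (T k').2 -> (T k).1.2 = (T k').1.2 ->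
  ((T k).1.1 < (T k').1.1)%N -> (k < k')%N.
Proof.
have /and5P[_ _ _ _ /forallP h] := hT; move=> e1 e2 lt.
by have /forallP /(_ k') := h k; rewrite e1 e2 !eqxx lt.
Qed.

Lemma std_eq k k' : f k = f k' -> (T k).1.2 = (T k').1.2 -> k = k'.
Proof.
move=> [e1 e2] e3; apply: std_inj.
by case: (T k) (T k') e1 e2 e3 => [[? ?] ?] [[? ?] ?] /= -> -> ->.
Qed.

(** Sending an entry to its column is a bijection onto the first b columns, since every node of the
    row is filled exactly once. *)
Lemma card_below (P : {set 'I_n}) (b : nat) (p : row) : (b <= lam p.1 p.2)%N ->
  (forall l, (l \in P) = (f l == p) && ((T l).1.2 < b)%N) -> #|P| = b.
Proof.
move=> hb hP.
have bn : (b <= n)%N by rewrite (leq_trans hb) // -ltnS.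
rewrite -(card_in_imset (f := fun l => (T l).1.2) (D := P)); last first.
  move=> l l'; rewrite !hP => /andP[/eqP e _] /andP[/eqP e' _] E.
  by apply: std_eq => //; rewrite e e'.
transitivity #|[set j : 'I_n | (j < b)%N]|; last first.
  rewrite -sum1dep_card -{2}[b]card_ord -sum1_card.
  by rewrite (big_ord_widen n (fun=> 1%N) bn).
apply: eq_card => j; rewrite inE; apply/imsetP/idP => [[l + ->]|jb].
  by rewrite hP => /andP[].
have [l hl] := @std_codom (p.2, j, p.1) (leq_trans jb hb).
by exists l; rewrite ?hP /f /tabrow hl //= -surjective_pairing eqxx.
Qed.

(** Rows increase, so the earlier entries in the row of [k] are exactly those to its left. *)
Lemma std_cnt (k : 'I_n) : cntf f k (f k) = (T k).1.2.
Proof.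
apply: (@card_below _ _ (f k)); first by apply: ltnW; apply: (std_node k).
move=> l; rewrite inE andbC; case: eqP => //= e.
case: (ltngtP (T l).1.2 (T k).1.2) => [h|h|h].
- exact: std_row h.
- by apply/negbTE; rewrite -leqNgt ltnW // (std_row _ h).
- by rewrite (std_eq e (val_inj h)) ltnn.
Qed.

Lemma std_cnt_all p : cntf f n p = lam p.1 p.2.
Proof.
apply: (@card_below _ _ p) => // l; rewrite inE ltn_ord /=; case: eqP => //= <-.
by symmetry; apply: std_node.
Qed.

(** Columns increase, so in each higher row the node in the column of [k] is already filled and that
    row is longer. *)
Lemma std_addable (k : 'I_n) : addable (wshape (fword f k)) (f k).
Proof.
rewrite wshape_fword; last exact: ltnW.
apply/addableP => i' lt; rewrite !ffunE std_cnt.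
have [hp _] := mpartP _ hlam.
have nd : is_node lam (i', (T k).1.2, (T k).2).
  rewrite /is_node /=; have := hp (T k).2 i' (T k).1.1 (ltnW lt); rewrite !ffunE /=.
  by apply: leq_trans; apply: std_node.
have [l hl] := std_codom nd.
have lk : (l < k)%N by apply: std_col; rewrite hl.
have fl : f l = ((f k).1, i') by rewrite /f /tabrow hl.
have := cntf_mono f ((f k).1, i') lk; apply: leq_trans.
by rewrite cntfS -fl eqxx add1n ltnS std_cnt hl.
Qed.

Lemma std_word : fword f n \in wordsof n (shp_of lam).
Proof.
rewrite mem_wordsof size_fword // eqxx /= wshape_fword //; apply/andP; split.
  by apply/eqP/ffunP => p; rewrite !ffunE std_cnt_all.
by apply/lword_fwordP; apply: std_addable.
Qed.

Lemma std_wcont (k : 'I_n) : wcont q (fword f n) k = content q T k.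
Proof.
rewrite wcont_fword // /rowend wshape_fword; last exact: ltnW.
by rewrite ffunE std_cnt.
Qed.

End Std.

Lemma std_word_inj lam T T' : standard lam T -> standard lam T' ->
  fword (tabrow T) n = fword (tabrow T') n -> T = T'.
Proof.
move=> hT hT' /fword_inj h; apply/ffunP => k.
have e : (T k).1.2 = (T' k).1.2.
  apply: val_inj; rewrite /= -(std_cnt hT) -(std_cnt hT') /cntf; apply: eq_card => l.
  by rewrite !inE !h.
have := h k; rewrite /tabrow; case: (T k) (T' k) e => [[? ?] ?] [[? ?] ?] /= -> [-> ->] //.
Qed.

Lemma std_word_surj lam Y : Y \in wordsof n (shp_of lam) ->
  exists2 T, standard lam T & Y = fword (tabrow T) n.
Proof.
rewrite mem_wordsof => /and3P[/eqP eY /eqP sY lY].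
have [f eYf] := fword_surj sY; rewrite eYf in eY lY *.
have {lY} /lword_fwordP ha := lY.
have tot p : cntf f n p = lam p.1 p.2.
  by have := congr1 (fun la : shp => la p) eY; rewrite wshape_fword // !ffunE.
have lt_cnt (k : 'I_n) : (cntf f k (f k) < lam (f k).1 (f k).2)%N.
  rewrite -tot; apply: leq_trans (cntf_mono f (f k) (ltn_ord k)).
  by rewrite cntfS eqxx.
have cn (k : 'I_n) : (cntf f k (f k) < n)%N by apply: leq_trans (lt_cnt k) _; rewrite -ltnS.
(* The column of an entry is the length of its row just before it is placed. *)
pose T : tableau m n := [ffun k => ((f k).2, Ordinal (cn k), (f k).1)].
have fT : tabrow T =1 f by move=> k; rewrite /tabrow ffunE /= -surjective_pairing.
have stepf (k k' : 'I_n) : (k < k')%N -> (cntf f k (f k) < cntf f k' (f k))%N.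
  by move=> kk; apply: leq_trans (cntf_mono f (f k) kk); rewrite cntfS eqxx.
have Tinj : injective T.
  move=> k k'; rewrite !ffunE => -[e2 ec e1].
  have ef : f k = f k' by rewrite [f k]surjective_pairing [f k']surjective_pairing e1 e2.
  case: (ltngtP k k') => [/stepf|/stepf|/val_inj //]; first by rewrite ec ef ltnn.
  by rewrite -ec -ef ltnn.
have Tnode k : is_node lam (T k) by rewrite /is_node ffunE /=; apply: lt_cnt.
exists T; last by rewrite /fword (eq_map fT).
apply/and5P; split.
- exact/injectiveP.
- exact/forallP.
- apply/forallP => -[[i j] c]; apply/implyP; rewrite /is_node /= -(tot (c, i)) => hj.
  have ex : exists k, (j < cntf f k (c, i))%N by exists n.
  (* The node in column [j] is filled at the step that first makes its row longer than [j]. *)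
  case: (ex_minnP ex) => -[|k] hk kmin.
    by move: hk; rewrite /cntf (_ : finset _ = set0) ?cards0 //; apply/setP => l; rewrite !inE.
  have kn : (k < n)%N by rewrite ltnNge; apply/negP => h; have := kmin n hj; rewrite ltnNge h.
  have hk' : (cntf f k (c, i) <= j)%N by rewrite leqNgt; apply/negP => /kmin; rewrite ltnn.
  have := cntfS f (Ordinal kn) (c, i); rewrite /= => E; rewrite E in hk.
  case: eqP hk => [fk|_] hk; last by move: hk; rewrite add0n ltnNge hk'.
  have -> : (i, j, c) = T (Ordinal kn); last exact: codom_f.
  rewrite ffunE; congr (_, _, _); [by rewrite fk| |by rewrite fk].
  apply: val_inj; rewrite /= fk.
  by apply/eqP; rewrite eqn_leq hk' andbT -ltnS -add1n.
- apply/forallP => k; apply/forallP => k'; apply/implyP; rewrite !ffunE /=.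
  move=> /and3P[/eqP e1 /eqP e2].
  have -> : f k = f k' by rewrite [f k]surjective_pairing [f k']surjective_pairing e1 e2.
  by apply: contraTltn => /(cntf_mono f (f k')) h; rewrite -leqNgt.
- apply/forallP => k; apply/forallP => k'; apply/implyP; rewrite !ffunE /=.
  move=> /and3P[/eqP e1 /eqP [e2] lt]; rewrite ltnNge; apply/negP => h.
  (* Addability at step k' makes the row of k longer than the common column, but up to step k its
     length is at most that column. *)
  have /addableP /(_ _ lt) := ha k'; rewrite wshape_fword; last exact: ltnW.
  rewrite !ffunE -e1 -surjective_pairing -e2 ltnNge.
  by rewrite (cntf_mono f (f k) h).
Qed.

End Tableaux.

Lemma span_mapP (R : fieldType) (V : vectType R) (I : eqType) (l : seq I) (F : I -> V) v :
  uniq l -> v \in <<[seq F i | i <- l]>>%VS -> exists c, v = \sum_(i <- l) c i *: F i.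
Proof.
elim: l v => [|i l IH] v /=.
  by rewrite span_nil memv0 => _ /eqP ->; exists (fun=> 0); rewrite big_nil.
case/andP=> il ul; rewrite span_cons => /memv_addP[_ /vlineP[k ->] [w /(IH _ ul) [c ->] ->]].
exists (fun j => if j == i then k else c j); rewrite big_cons eqxx; congr (_ + _).
rewrite !big_seq; apply: eq_bigr => j hj; case: eqP => // e; by rewrite -e hj in il.
Qed.

(** * The Schur elements *)

Section Schur.
Variables (R : fieldType) (m n : nat) (q : 'I_m -> R) (A : falgType R).
Variables (s : nat -> A) (g : {perm 'I_n} -> A).
Variable rho : forall lam : MP m n, A -> 'M[R]_(#|stdT lam|).
Hypothesis m_gt0 : (0 < m)%N.
Hypothesis n_gt0 : (0 < n)%N.
Hypothesis hsep : separated n q.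
Hypothesis hrel : hecke_rel n q s.
Hypothesis g1 : g 1%g = 1.
Hypothesis gt : forall i j : 'I_n, (j : nat) = i.+1 -> g (tperm i j) = s j.
Hypothesis gM : forall u v, g (u * v)%g = g u * g v.
Hypothesis hbasis : basis_of fullv [seq mono s g p | p : HIdx m n].
Hypothesis hrho : forall lam : MP m n, mpart lam ->
  [/\ rho lam 1 = 1%:M,
      (forall a b, rho lam (a * b) = rho lam a *m rho lam b),
      (forall (k : R) a b, rho lam (k *: a + b) = k *: rho lam a + rho lam b)
    & (forall k : 'I_n, rho lam (jm s k)
         = diag_mx (\row_u content q (enum_val u) k))].
Local Notation row := ('I_m * 'I_n)%type.
Local Notation shp := {ffun row -> nat}.

Definition tabword (lam : MP m n) (u : 'I_#|stdT lam|) : seq row :=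
  fword (tabrow (enum_val u)) n.

Lemma stdT_standard (lam : MP m n) (u : 'I_#|stdT lam|) : standard lam (enum_val u).
Proof. by have := enum_valP u; rewrite inE. Qed.

Lemma tabword_inj lam : injective (@tabword lam).
Proof.
by move=> u v h; apply: enum_val_inj; apply: std_word_inj h; apply: stdT_standard.
Qed.

Lemma tabword_surj lam Y : Y \in wordsof n (shp_of lam) -> exists u, Y = @tabword lam u.
Proof.
move=> /std_word_surj[T hT ->]; have hT' : T \in stdT lam by rewrite inE.
by exists (enum_rank_in hT' T); rewrite /tabword enum_rankK_in.
Qed.

Lemma tabword_mem lam u : mpart lam -> @tabword lam u \in wordsof n (shp_of lam).
Proof. by move=> h; apply: std_word => //; apply: stdT_standard. Qed.

Lemma sum_tabword lam (F : seq row -> R) : mpart lam ->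
  \sum_(Y <- wordsof n (shp_of lam)) F Y = \sum_u F (@tabword lam u).
Proof.
move=> h; rewrite -(big_map (@tabword lam) xpredT F); apply: perm_big.
apply: uniq_perm; first exact: wordsof_uniq.
  by rewrite map_inj_uniq ?index_enum_uniq //; apply: tabword_inj.
move=> Y; apply/idP/mapP => [/tabword_surj[u ->]|[u _ ->]]; last exact: tabword_mem.
by exists u => //; rewrite mem_index_enum.
Qed.

(** Matrix entries transported to words. The default 0 preserves linearity for all pairs of words,
    as [wrep] demands. *)
Definition rho_word (lam : MP m n) (a : A) (Y Z : seq row) : R :=
  if [pick u | @tabword lam u == Y] is Some u then
    if [pick v | @tabword lam v == Z] is Some v then rho lam a u v else 0
  else 0.

Lemma rho_wordE lam a u v : rho_word lam a (@tabword lam u) (@tabword lam v) = rho lam a u v.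
Proof.
rewrite /rho_word; case: pickP => [u' /eqP /tabword_inj ->|/(_ u)]; last by rewrite eqxx.
by case: pickP => [v' /eqP /tabword_inj ->|/(_ v)]; last by rewrite eqxx.
Qed.

Lemma rho_wrep lam : mpart lam -> wrep q s n (shp_of lam) (rho_word lam).
Proof.
move=> h; have [r1 rM rL rX] := hrho h.
split=> [T U hT hU|a b _ _ T U hT hU|k a b T U|k T U hk hT hU].
- have [u ->] := tabword_surj hT; have [v ->] := tabword_surj hU.
  by rewrite rho_wordE r1 mxE (inj_eq (@tabword_inj lam)).
- have [u ->] := tabword_surj hT; have [v ->] := tabword_surj hU.
  rewrite rho_wordE rM mxE sum_tabword //; apply: eq_bigr => l _.
  by rewrite !rho_wordE.
- rewrite /rho_word; case: pickP => [u _|_]; last by rewrite mulr0 addr0.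
  by case: pickP => [v _|_]; rewrite ?mulr0 ?addr0 // rL !mxE.
- have [u ->] := tabword_surj hT; have [v ->] := tabword_surj hU.
  rewrite rho_wordE (rX (Ordinal hk)) !mxE (inj_eq (@tabword_inj lam)).
  rewrite (std_wcont q (stdT_standard u) (Ordinal hk)).
  by case: (u == v); rewrite ?mul1r ?mul0r ?mulr1n ?mulr0n.
Qed.

Lemma tr_rho lam a : mpart lam ->
  \tr (rho lam a) = \sum_(Y <- wordsof n (shp_of lam)) rho_word lam a Y Y.
Proof. by move=> h; rewrite sum_tabword //; apply: eq_bigr => u _; rewrite rho_wordE. Qed.

Definition shp_rep (la : shp) := rho_word (mp_of la).

Lemma shp_rep_wrep la : partp la -> shsize la = n -> wrep q s n la (shp_rep la).
Proof.
move=> hla hs; have E : shp_of (mp_of la) = la by rewrite mp_ofK ?hs.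
by rewrite -{1}E; apply: rho_wrep; apply/mpartP; rewrite E.
Qed.

Lemma sum_mpart a :
  \sum_(lam : MP m n | mpart lam) \tr (rho lam a) / schur1 q lam
  = \sum_(T <- lwords m n n) shp_rep (wshape T) a T T / hookprod q (wshape T).
Proof.
have hT T : T \in lwords m n n -> [/\ partp (wshape T), shsize (wshape T) = n
    & shp_of (mp_of (wshape T)) = wshape T].
  rewrite mem_lwords => /andP[/eqP sT lT].
  by split; [exact: partp_shape | rewrite shsize_shape | rewrite mp_ofK // shsize_shape sT].
rewrite [RHS]big_seq (partition_big (fun T => mp_of (wshape T)) (@mpart m n)) /=; last first.
  by move=> T /hT[h1 h2 h3]; apply/mpartP; rewrite h3.
apply: eq_bigr => lam hlam; rewrite tr_rho // mulr_suml big_filter big_seq_cond.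
apply: eq_big => [T|T /andP[_ /eqP eT]].
  apply: andb_id2l => /hT[_ _ h3]; apply/eqP/eqP => [->|<-]; [exact: shp_ofK|exact: esym].
by rewrite /shp_rep eT shp_ofK hookprod_schur1.
Qed.

Lemma schur_mono (p : HIdx m n) :
  \sum_(lam : MP m n | mpart lam) \tr (rho lam (mono s g p)) / schur1 q lam
  = (topidx p)%:R.
Proof.
pose e k := if insub k is Some l then nat_of_ord (p.1 l) else 0%N.
have eE (k : 'I_n) : e k = p.1 k by rewrite /e valK.
have -> : mono s g p = xmon s n e * g p.2.
  by congr (_ * _); apply: eq_bigr => k _; rewrite eE.
(* The reference row is row 0 of component 0, which exists as m and n are positive. *)
rewrite sum_mpart (wrep_trace hsep hrel g1 gt gM (p0 := (Ordinal m_gt0, Ordinal n_gt0))) //.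
- congr _%:R; rewrite /topidx andbC; congr (_ && _).
  apply/allP/forallP => [h k|h k]; first by rewrite -eE h // mem_iota /=.
  by rewrite mem_iota /= => hk; have := h (Ordinal hk); rewrite -eE.
- exact: shp_rep_wrep.
- by move=> k hk; rewrite (eE (Ordinal hk)).
- by move=> i; rewrite leqNgt ltn_ord.
Qed.

Lemma rho_sum lam (I : Type) (l : seq I) (c : I -> R) (F : I -> A) : mpart lam ->
  rho lam (\sum_(i <- l) c i *: F i) = \sum_(i <- l) c i *: rho lam (F i).
Proof.
move=> h; have [_ _ rL _] := hrho h; elim: l => [|i l IH]; last by rewrite !big_cons rL IH.
by rewrite !big_nil; have := rL (-1) 0 0; rewrite scaler0 addr0 scaleN1r addNr.
Qed.

Lemma schur_trace (c : HIdx m n -> R) :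
  tauc c = \sum_(lam : MP m n | mpart lam)
             \tr (rho lam (\sum_p c p *: mono s g p)) / schur1 q lam.
Proof.
transitivity (\sum_p c p * \sum_(lam : MP m n | mpart lam)
    \tr (rho lam (mono s g p)) / schur1 q lam).
  rewrite /tauc big_mkcond; apply: eq_bigr => p _; rewrite schur_mono.
  by case: topidx; rewrite ?mulr1 ?mulr0.
under eq_bigr do rewrite mulr_sumr.
rewrite exchange_big; apply: eq_bigr => lam h; rewrite rho_sum // raddf_sum mulr_suml.
by apply: eq_bigr => p _; rewrite /= mxtraceZ mulrA.
Qed.

(* A product of interpolation polynomials in the Jucys--Murphy elements isolates
   the weight of a single word among all words of length n. *)
Lemma weight_idempotent Y : Y \in lwords m n n -> exists b : A,
  forall (la : shp) pi, wrep q s n la pi ->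
  forall T, T \in wordsof n la -> pi b T T = (T == Y)%:R.
Proof.
move=> hY.
(* At level n the commutation condition is empty, so [wrep] is multiplicative on all of A. *)
have triv a : jmcomm n s n a by move=> k /andP[h1]; rewrite ltnNge h1.
have step k : (k <= n)%N -> exists b : A, forall (la : shp) pi, wrep q s n la pi ->
    forall T, T \in wordsof n la ->
    pi b T T = (all (fun l => wcont q T l == wcont q Y l) (iota 0 k))%:R.
  elim: k => [|k IH] hk; first by exists 1 => la pi [h1 _ _ _] T hT; rewrite h1 // eqxx.
  have [b hb] := IH (ltnW hk).
  have [f hf] := interpolation [seq wcont q T k | T <- lwords m n n]
    (fun z => (z == wcont q Y k)%:R).
  exists (\sum_(i < size f) f`_i *: (b * jm s k ^+ i)) => la pi hpi T hT.
  have [_ _ pL _] := hpi.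
  have p0 : pi 0 T T = 0 by have := pL (-1) 0 0 T T; rewrite scaler0 addr0 mulN1r addNr.
  have -> : pi (\sum_(i < size f) f`_i *: (b * jm s k ^+ i)) T T
      = \sum_(i < size f) f`_i * pi (b * jm s k ^+ i) T T.
    elim: (index_enum _) => [|i l IHl]; first by rewrite !big_nil.
    by rewrite !big_cons pL IHl.
  under eq_bigr do rewrite (wrep_jmXr hrel hpi) // (hb _ _ hpi) // mulrCA.
  rewrite -mulr_sumr -horner_coef hf; last first.
    by apply: map_f; move: hT; rewrite mem_filter => /andP[].
  by rewrite -natrM mulnb -[in RHS]addn1 iotaD all_cat /= add0n andbT.
have [b hb] := step n (leqnn n); exists b => la pi hpi T hT; rewrite (hb _ _ hpi) //.
congr (nat_of_bool _)%:R; apply/allP/eqP => [h|-> //].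
apply: (wcont_inj hsep (leqnn n)) => //; first by move: hT; rewrite mem_filter => /andP[].
by move=> k hk; apply/eqP/h; rewrite mem_iota.
Qed.

(** An element isolating the weight of one word of shape [lam] has trace 1 on S^lam and 0 on the
    other modules. Applying both expansions of tau to it compares the two inverses. *)
Lemma schur_unique (sl : MP m n -> R) :
  (forall c : HIdx m n -> R,
     tauc c = \sum_(lam : MP m n | mpart lam)
                \tr (rho lam (\sum_p c p *: mono s g p)) / sl lam) ->
  forall lam : MP m n, mpart lam -> sl lam = schur1 q lam.
Proof.
move=> hsl lam hlam; have [hp hs] := mpartP _ hlam.
have [Y hY eY] := lwords_shape_exists hp hs.
have [b hb] := weight_idempotent hY.
have [c ec] : exists c : HIdx m n -> R, b = \sum_p c p *: mono s g p.
  have hb' : b \in <<[seq mono s g p | p : HIdx m n]>>%VS by rewrite (span_basis hbasis) memvf.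
  have [c ->] := span_mapP (enum_uniq _) hb'; exists c; by rewrite big_enum.
have trb mu : mpart mu -> \tr (rho mu b) = (mu == lam)%:R.
  move=> hmu; rewrite tr_rho // big_seq.
  rewrite (eq_bigr (fun T => 1 * (T == Y)%:R)); last first.
    by move=> T hT; rewrite (hb _ _ (rho_wrep hmu)) // mul1r.
  rewrite -big_seq; case: eqP => [->|ne].
    by rewrite (sum_wordsof_delta (fun=> 1)) // mem_filter eY eqxx.
  rewrite big_seq big1 // => T; rewrite mem_filter => /andP[/eqP eT _].
  case: eqP => [e|_]; last by rewrite mulr0.
  by case: ne; rewrite -[mu]shp_ofK -eT e eY shp_ofK.
have pick (S : MP m n -> R) :
    \sum_(mu : MP m n | mpart mu) \tr (rho mu b) / S mu = (S lam)^-1.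
  rewrite (bigD1 lam) //= trb // eqxx mul1r big1 ?addr0 // => mu /andP[hmu ne].
  by rewrite trb // (negbTE ne) mul0r.
apply: invr_inj; rewrite -(pick sl) -(pick (schur1 q)) ec -hsl.
exact: schur_trace.
Qed.

End Schur.

Lemma schur12 (R : fieldType) (m n : nat) (q : 'I_m -> R) (lam : MP m n) :
  schur1 q lam = schur2 q lam.
Proof.
apply: eq_bigr => t _; apply: eq_bigr => i _; apply: eq_bigr => j _.
by rewrite (bigD1 t) //= addrK.
Qed.

Unset Implicit Arguments.

Theorem theorem4p2 (R : fieldType) (m n : nat) (q : 'I_m -> R)
    (A : falgType R) (s : nat -> A) (g : {perm 'I_n} -> A)
    (rho : forall lam : MP m n, A -> 'M[R]_(#|stdT lam|)) :
  (0 < m)%N -> (0 < n)%N -> separated n q ->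
  (* A is H_{m,n}(Q): generators s_0..s_{n-1} satisfy the relations ... *)
  hecke_rel n q s ->
  (* ... g is the copy of S_n generated by s_1..s_{n-1} ... *)
  g 1%g = 1 ->
  (forall i j : 'I_n, (j : nat) = i.+1 -> g (tperm i j) = s j) ->
  (forall u v, g (u * v)%g = g u * g v) ->
  (* ... and the monomials x^i w form an R-basis of A *)
  basis_of fullv [seq mono s g p | p : HIdx m n] ->
  (* rho lam is the representation S^lam: seminormal basis indexed by
     standard lam-tableaux with x_k acting by contents *)
  (forall lam : MP m n, mpart lam ->
     [/\ rho lam 1 = 1%:M,
         (forall a b, rho lam (a * b) = rho lam a *m rho lam b),
         (forall (k : R) a b, rho lam (k *: a + b) = k *: rho lam a + rho lam b)
       & (forall k : 'I_n, rho lam (jm s k)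
            = diag_mx (\row_u content q (enum_val u) k))]) ->
  (* tau = sum_lam chi^lam / s_lam with s_lam = the product formula ... *)
  [/\ (forall c : HIdx m n -> R,
         tauc c = \sum_(lam : MP m n | mpart lam)
                    \tr (rho lam (\sum_p c p *: mono s g p)) / schur1 q lam),
      (* ... the Schur elements are uniquely determined by this ... *)
      (forall sl : MP m n -> R,
         (forall c : HIdx m n -> R,
            tauc c = \sum_(lam : MP m n | mpart lam)
                       \tr (rho lam (\sum_p c p *: mono s g p)) / sl lam) ->
         forall lam : MP m n, mpart lam -> sl lam = schur1 q lam)
    & (* ... and the two product formulas agree *)
      (forall lam : MP m n, mpart lam -> schur1 q lam = schur2 q lam)].
Proof.
move=> hm hn hsep hrel g1 gt gM hbasis hrho; split.
- exact: schur_trace.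
- by move=> sl; apply: (schur_unique hm hn hsep hrel g1 gt gM hbasis hrho).
- by move=> lam _; apply: schur12.
Qed.
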